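(* Let $\varphi\colon[0,1]\to[0,\infty)$ be an increasing, concave function, not identically zero, with $\varphi(0)=0$ and $\lim_{t\to0^+}\varphi(t)=0$ (so that $\Lambda(\varphi)\ne L^\infty$). For the Lorentz space $\Lambda(\varphi)$ we have $$\|F_y\|_{\Lambda(\varphi)}=\int_0^{1-y}\frac{\varphi'(t)}{t+y}\,dt,\qquad y\in(0,1],$$ where $F_y(x):=\frac1x\chi_{[y,1]}(x)$ for $0<x\le1$, and $$|m_{\Lambda(\varphi)}|([0,1])=\int_0^1\log(1/t)\,\varphi'(t)\,dt .$$ Consequently, $m_{\Lambda(\varphi)}$ has finite variation precisely when the function $t\mapsto\log(1/t)$ belongs to $\Lambda(\varphi)$ and, in that case, $|m_{\Lambda(\varphi)}|([0,1])=\|\log(1/t)\|_{\Lambda(\varphi)}$.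
   Context: $\lambda$ is Lebesgue measure on $[0,1]$, $\mathcal{M}$ the $\sigma$-algebra of Lebesgue measurable subsets of $[0,1]$, $f^*$ the decreasing rearrangement of a measurable function $f$ on $[0,1]$ (right-continuous inverse of $\tau\mapsto\lambda(\{|f|>\tau\})$). The Lorentz space $\Lambda(\varphi)$ consists of all (classes of) measurable functions $f$ on $[0,1]$ with $\|f\|_{\Lambda(\varphi)}:=\int_0^1 f^*(s)\,d\varphi(s)<\infty$. The Cesàro operator is $\mathcal{C}(f)(x):=\frac1x\int_0^x f(t)\,dt$. For $X=\Lambda(\varphi)$, $m_X\colon\mathcal{M}\to X$ is the ($\sigma$-additive) vector measure $m_X(A):=\mathcal{C}(\chi_A)$. Its variation is $|m_X|(A)=\sup\sum_i\|m_X(A_i)\|_X\in[0,\infty]$, the supremum over finite measurable partitions $(A_i)$ of $A$; $m_X$ has finite variation if $|m_X|([0,1])<\infty$. *)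

(* Defs.v *)
From HB Require Import structures.
From mathcomp Require Import all_boot all_order all_algebra.
From mathcomp Require Import all_classical all_reals all_analysis.

Set Implicit Arguments.
Unset Strict Implicit.
Unset Printing Implicit Defensive.

Import Order.TTheory GRing.Theory Num.Theory.
Import numFieldNormedType.Exports.

Local Open Scope classical_set_scope.
Local Open Scope ring_scope.

(* Measurable functions on [0,1] are represented by total functions R -> R, of
   which only the almost everywhere class of the restriction to [0,1] matters;
   values at 0 follow the conventions 0^-1 = 0 and ln 0 = 0. *)

Section lebesgue.
Context {R : realType}.
Implicit Types (A D : set R) (f : R -> R).

(* R with the sigma-algebra of Lebesgue (not just Borel) measurable sets *)
Definition lebesgueR := caratheodory_type ((wlength (@idfun R))^*)%mu.

Definition lebesgue_measurable A : Prop := measurable (A : set lebesgueR).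

Definition lebesgue_measurable_fun D f : Prop :=
  measurable_fun (D : set lebesgueR) (f : lebesgueR -> R).

Definition lebesgue_integral D (f : R -> \bar R) : \bar R :=
  (\int[@completed_lebesgue_measure R]_(t in (D : set lebesgueR)) f t)%E.

End lebesgue.

(* "Increasing" is meant in the wide sense. Only the values of [weight_fun] on
   [0,1] matter. *)
Record lorentz_weight (R : realType) := LorentzWeight {
  weight_fun :> R -> R ;
  weight_ge0 : {in `[0, 1], forall t, 0 <= weight_fun t} ;
  weight_nondecreasing : {in `[0, 1] &, {homo weight_fun : s t / s <= t}} ;
  weight_concave :
    convex_function (`[0, 1]%classic : set R^o) (\- weight_fun) ;
  weight0 : weight_fun 0 = 0 ;
  weight_cvg0 : weight_fun t @[t --> 0^'+] --> 0 ;
  weight_neq0 : exists2 t, t \in `[0, 1] & weight_fun t != 0 }.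

(* The extension of the weight to the whole line by constants; it is a
   cumulative function, whose Stieltjes measure is the measure d phi, carried
   by [0,1]. *)
Section weight_ext.
Context {R : realType} (phi : lorentz_weight R).

Definition weight_ext (t : R) : R := phi (Num.max 0 (Num.min t 1)).

Let clamp_itv (t : R) : Num.max 0 (Num.min t 1) \in `[0, 1].
Proof. by rewrite in_itv/= le_max lexx/= ge_max ler01/= ge_min lexx orbT. Qed.

Lemma weight_ext_nondecreasing : nondecreasing weight_ext.
Proof.
move=> s t st; apply: weight_nondecreasing; rewrite ?clamp_itv//.
rewrite ge_max !le_max lexx/=; apply/orP; right.
by rewrite le_min !ge_min st/= lexx orbT.
Qed.

Let weight_ext_ge0 t : 0 <= weight_ext t.
Proof. exact: weight_ge0 (clamp_itv t). Qed.

Let clampE (t : R) : 0 <= t -> t <= 1 -> Num.max 0 (Num.min t 1) = t.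
Proof. by move=> t0 t1; rewrite (min_idPl t1) (max_idPr t0). Qed.

Let weight_star (t u : R) : 0 < t -> t <= u -> u <= 1 ->
  phi u <= u / t * phi t.
Proof.
move=> t0 tu u1; have u0 : 0 < u by exact: lt_le_trans tu.
have q0 : 0 <= t / u by rewrite divr_ge0// ltW.
have q1 : t / u <= 1 by rewrite ler_pdivrMr// mul1r.
have qi : Itv.spec (Itv.num_sem (R:=R)) (Itv.Real `[0%Z, 1%Z]) (t / u).
  by apply/and3P; split; rewrite /= ?num_real// in_itv/= q0 q1.
have := @weight_concave _ phi (Itv.mk qi) u 0.
rewrite !inE/= !in_itv/= lexx ler01 (ltW u0) u1 => /(_ isT isT).
rewrite !convRE /conv/= /GRing.scale/= mulr0 addr0 weight0 oppr0 mulr0 addr0.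
rewrite divfK ?gt_eqF// mulrN lerN2 => H.
by rewrite -ler_pdivrMl ?divr_gt0// invf_div.
Qed.

Let weight_ext_star (t u : R) : 0 < t -> t <= u ->
  weight_ext u <= u / t * weight_ext t.
Proof.
move=> t0 tu; have ut1 : 1 <= u / t by rewrite ler_pdivlMr// mul1r.
have [t1|t1] := leP 1 t.
  rewrite /weight_ext (min_idPr t1) (min_idPr (le_trans t1 tu)).
  by rewrite ler_peMl// (max_idPr ler01) weight_ge0// in_itv/= ler01 lexx.
have [u1|u1] := leP u 1.
  rewrite /weight_ext !clampE ?(ltW t0) ?(ltW t1)//; first exact: weight_star.
  by rewrite (le_trans (ltW t0)).
rewrite /weight_ext (min_idPr (ltW u1)) (max_idPr ler01) clampE ?(ltW t0) ?(ltW t1)//.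
have /le_trans -> // := weight_star t0 (ltW t1) (lexx 1).
apply: ler_wpM2r; first by rewrite weight_ge0// in_itv/= ltW//= ltW.
by apply: ler_wpM2r; rewrite ?invr_ge0 ltW.
Qed.

Lemma weight_ext_right_continuous : right_continuous weight_ext.
Proof.
move=> t; have [t0|t0|->] := ltgtP t 0.
- have weight_ext_le0 (u : R) : u <= 0 -> weight_ext u = phi 0.
    move=> u0; rewrite /weight_ext (min_idPl (le_trans u0 ler01)).
    by rewrite (max_idPl u0).
  apply: cvg_near_cst; near=> u; rewrite !weight_ext_le0//; first exact: ltW.
  by near: u; exact: nbhs_right_le.
- have tE : t / t * weight_ext t = weight_ext t.
    by rewrite divff ?mul1r// gt_eqF.
  have cu : u / t * weight_ext t @[u --> t^'+] --> weight_ext t.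
    rewrite -[X in _ --> X]tE; apply: cvgM; last exact: cvg_cst.
    by apply: cvgM; [exact: cvg_within|exact: cvg_cst].
  apply: squeeze_cvgr (cvg_cst (weight_ext t)) cu.
  near=> u; have tu : t <= u by near: u; exact: nbhs_right_ge.
  by rewrite weight_ext_nondecreasing//= weight_ext_star.
- have -> : weight_ext 0 = 0 by rewrite /weight_ext clampE// weight0.
  apply: cvg_trans (weight_cvg0 phi); apply: near_eq_cvg.
  near=> u; rewrite /weight_ext clampE//; near: u.
  exact: nbhs_right_le.
Unshelve. all: by end_near. Qed.

HB.instance Definition _ := isCumulative.Build R _ R weight_ext
  weight_ext_nondecreasing weight_ext_right_continuous.

End weight_ext.

Section lorentz.
Context {R : realType}.
Implicit Types (phi : lorentz_weight R) (f : R -> R) (A : set R).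
Local Open Scope ereal_scope.

Definition distribution01 f (tau : R) : \bar R :=
  @completed_lebesgue_measure R
    ([set x | (x \in `[0, 1] /\ tau < `|f x|)%R] : set lebesgueR).

(* The decreasing rearrangement; it may take the value +oo at s = 0. *)
Definition rearrangement f (s : R) : \bar R :=
  ereal_inf [set tau%:E | tau in [set tau : R |
    (0 <= tau)%R /\ distribution01 f tau <= s%:E]].

Definition lorentz_norm phi f : \bar R :=
  \int[lebesgue_stieltjes_measure (weight_ext phi)]_(s in `[0%R, 1%R])
    rearrangement f s.

Definition in_lorentz phi f : Prop :=
  lebesgue_measurable_fun `[0%R, 1%R] f /\ lorentz_norm phi f < +oo.

Definition cesaro f (x : R) : R :=
  (x^-1 * fine (lebesgue_integral `[0%R, x] (fun t => (f t)%:E)))%R.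

Definition cesaro_vmeasure A : R -> R := cesaro \1_A.

(* The variation of a function-valued set function m, relative to the
   (extended-valued) norm N; parts of a partition may be empty. *)
Definition variation (N : (R -> R) -> \bar R) (m : set R -> R -> R) A
    : \bar R :=
  ereal_sup [set v | exists n (P : 'I_n -> set R),
    [/\ forall i, lebesgue_measurable (P i),
        trivIset setT P,
        \bigcup_i P i = A &
        v = \sum_(i < n) N (m (P i))]].

Definition lorentz_variation phi : set R -> \bar R :=
  variation (lorentz_norm phi) cesaro_vmeasure.

Definition finite_variation phi : Prop :=
  lorentz_variation phi `[0%R, 1%R] < +oo.

Definition Fker (y x : R) : R := (x^-1 * \1_(`[y, 1%R]%classic) x)%R.

End lorentz.

(* Main.v *)
Require Import Defs.
From HB Require Import structures.
From mathcomp Require Import all_boot all_order all_algebra.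
From mathcomp Require Import all_classical all_reals all_analysis.
From mathcomp Require Import measurable_realfun ring lra.

Import Order.TTheory GRing.Theory Num.Theory.
Import numFieldNormedType.Exports.
Local Open Scope classical_set_scope.
Local Open Scope ring_scope.

Set Implicit Arguments.
Unset Strict Implicit.
Unset Printing Implicit Defensive.

(** Write [f*] for the rearrangement of [f], [F_y] for [Fker y], and [w] for the
    right derivative of [phi]: it is nonincreasing on ]0,1], [d phi = w dt], and
    [phi' = w] almost everywhere, so [lorentz_norm phi f] is the integral of
    [f* w].

    Upper bound of the variation: by the layer cake formula for [w], whose
    superlevel sets are initial intervals, it suffices to bound
    [sum_i int_0^s m(P_i)*] by [int_0^s log(1/t) dt] for every [s].  Since
    [int_0^s f* <= s tau + int (|f| - tau)^+] for all [tau], and since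
    [m(A) = int_A F_y dy], taking [tau = int_A F_y*(s) dy] gives
    [int_0^s m(A)* <= int_A int_0^s F_y*(t) dt dy].  The right-hand side is
    additive in [A], and equals [int_0^s log(1/t) dt] for [A = [0,1]] because
    [int_0^1 F_y*(t) dy = log(1/t)].

    Lower bound: on a partition into intervals of length [h] with right ends
    [y_i], [m(P_i) >= h F_{y_i}], so the sum of the norms dominates a Riemann
    sum of the decreasing function [y |-> F_y*(t)], integrated against [w];
    let [h] tend to 0. *)

(** * Layer cake formula and the completed Lebesgue measure *)

Section layer_cake.
Local Open Scope ereal_scope.
Context d (T : measurableType d) (R : realType).
Variable mu : {sigma_finite_measure set T -> \bar R}.

(** Tonelli for [k] on the region [E] below the graph of [g], under the product of [mu] and Lebesgue
    measure: integrating first in [u] gives the left side, first in [x] the right side. *)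
Let layer_cakeT (g k : T -> \bar R) :
  measurable_fun setT g -> measurable_fun setT k ->
  (forall x, 0 <= g x) -> (forall x, 0 <= k x) ->
  \int[mu]_x (k x * g x) =
  \int[lebesgue_measure]_(u in `[0%R, +oo[)
    \int[mu]_(x in [set x | u%:E < g x]) k x.
Proof.
move=> mg mk g0 k0.
pose E := [set p : T * R | (0 <= p.2)%R /\ p.2%:E < g p.1].
have mE : measurable E.
  have := @measurable_lte _ _ R ((@snd T R) @^-1` `[0%R, +oo[)
    _ (fun p => p.2%:E) (fun p => g p.1).
  rewrite (_ : _ `&` _ = E); last first.
    by apply/seteqP; split => -[x u] /=; rewrite in_itv/= andbT.
  apply.
  - by rewrite -[X in measurable X]setTI; exact: measurable_snd.
  - by apply: measurable_funTS; apply/measurable_EFinP; exact: measurable_snd.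
  - apply: measurable_funTS; apply: (measurableT_comp mg).
    exact: measurable_fst.
pose h := (fun p : T * R => k p.1) \_ E.
have mh : measurable_fun setT h.
  apply/(measurable_restrictT _ mE); apply: measurable_funTS.
  by apply: (measurableT_comp mk); exact: measurable_fst.
have h0 p : 0 <= h p by rewrite /h patchE; case: ifPn.
have := @fubini_tonelli _ _ _ _ R mu (@lebesgue_measure R) h mh h0.
have -> : \int[mu]_x \int[lebesgue_measure]_u h (x, u) =
    \int[mu]_x (k x * g x).
  apply: eq_integral => x _.
  transitivity (\int[lebesgue_measure]_(u in
      [set u : R | (0 <= u)%R /\ u%:E < g x]) cst (k x) u).
    rewrite [RHS]integral_mkcond; apply: eq_integral => u _.
    rewrite /h !patchE; congr (if _ then _ else _).

  (* The slice of [E] over [x] is an interval of length [g x], a half-line when [g x] is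
     infinite. *)
  have -> : [set u : R | (0 <= u)%R /\ u%:E < g x] =
     if g x is r%:E then `[0%R, r[%classic else `[0%R, +oo[%classic.
    apply/seteqP; have := g0 x; case: (g x) => [r| |]// _; split => u /=;
    rewrite in_itv/= ?andbT ?ltry ?lte_fin.
    - by move=> [-> ->].
    - by move=> /andP.
    - by move=> [].
    - by move=> u0; split.
  have := g0 x; case: (g x) => [r| |]// r0.
  - rewrite integral_cst; last exact: measurable_itv.
    congr (_ * _); rewrite [LHS]lebesgue_measure_itv/= lte_fin.
    move: r0; rewrite lee_fin le_eqVlt => /orP[/eqP<-|->].
      by rewrite ltxx.
    by rewrite sube0.
  - rewrite integral_cst; last exact: measurable_itv.
    by congr (_ * _); rewrite [LHS]lebesgue_measure_itv/= ltry.
move=> ->; rewrite [RHS]integral_mkcond; apply: eq_integral => u _.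
rewrite patchE; case: ifPn => [|/negP u0].
  rewrite inE/= in_itv/= andbT => u0.
  rewrite [RHS]integral_mkcond; apply: eq_integral => x _.
  rewrite /h !patchE; congr (if _ then _ else _).
  by apply/idP/idP; rewrite !inE => // -[].
apply: integral0_eq => x _; rewrite /h patchE ifF//.
apply/negP; rewrite inE => -[/= u0' _]; apply: u0.
by rewrite inE/= in_itv/= andbT.
Qed.

(** Extend [g] and [k] by zero: since [u >= 0], the superlevel sets of the extended [g] stay inside
    [D]. *)
Lemma weighted_layer_cake (D : set T) (g k : T -> \bar R) : measurable D ->
  measurable_fun D g -> measurable_fun D k ->
  (forall x, D x -> 0 <= g x) -> (forall x, D x -> 0 <= k x) ->
  \int[mu]_(x in D) (k x * g x) =
  \int[lebesgue_measure]_(u in `[0%R, +oo[)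
    \int[mu]_(x in D `&` [set x | u%:E < g x]) k x.
Proof.
move=> mD mg mk g0 k0.
have mg' := (measurable_restrictT _ mD).1 mg.
have mk' := (measurable_restrictT _ mD).1 mk.
rewrite integral_mkcond.
transitivity (\int[mu]_x ((k \_ D) x * (g \_ D) x)).
  apply: eq_integral => x _; rewrite !patchE.
  by case: ifPn => //; rewrite mule0.
rewrite (layer_cakeT mg' mk'); last 2 first.
- by move=> x; rewrite patchE; case: ifPn => // /set_mem/g0.
- by move=> x; rewrite patchE; case: ifPn => // /set_mem/k0.
- apply: eq_integral => u; rewrite inE/= in_itv/= andbT => u0.
  rewrite [LHS]integral_mkcond [RHS]integral_mkcond.
  apply: eq_integral => x _; rewrite !patchE; case: ifPn; rewrite ?inE/=.
    rewrite patchE; case: ifPn => [xD|_]; last by rewrite lte_fin ltNge u0.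
    by move=> ugx; rewrite mem_set//; split => //; exact/set_mem.
  rewrite notin_setE/= patchE; case: ifPn => [xD|xD _].
    by move=> ugx; rewrite memNset// => -[].
  by rewrite memNset// => -[Dx _]; rewrite mem_set in xD.
Qed.

End layer_cake.

Section completed_lebesgue.
Local Open Scope ereal_scope.
Context {R : realType}.
Implicit Types (A D : set R) (f : R -> \bar R).
Local Notation mu := (@lebesgue_measure R).
Local Notation cmu := (@completed_lebesgue_measure R).

Lemma measurable_lebesgue A : measurable A -> lebesgue_measurable A.
Proof. by move=> mA; apply: sub_caratheodory. Qed.

Lemma measurable_id_lebesgue : measurable_fun setT (id : lebesgueR -> R).
Proof. by move=> _ A mA; rewrite setTI; exact: measurable_lebesgue. Qed.

Lemma measurable_fun_lebesgue d (T : measurableType d) D (f : R -> T) :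
  measurable D -> measurable_fun D f ->
  measurable_fun (D : set lebesgueR) (f : lebesgueR -> T).
Proof.
by move=> mD mf _ B mB; apply: measurable_lebesgue; exact: mf.
Qed.

(** The identity, measurable from the Lebesgue to the Borel sigma-algebra, pushes the completed
    measure forward to Lebesgue measure on Borel sets. *)
Lemma ge0_lebesgue_integralE D f : measurable D -> measurable_fun D f ->
  (forall x, D x -> 0 <= f x) -> lebesgue_integral D f = \int[mu]_(x in D) f x.
Proof.
move=> mD mf f0; rewrite /lebesgue_integral.
rewrite -(@ge0_integral_pushforward _ _ lebesgueR (measurableTypeR R) R
  id measurable_id_lebesgue cmu D f mD mf)//; last first.
  by move=> x /set_mem /f0.
Qed.

End completed_lebesgue.

Section monotone_measurable.
Local Open Scope ereal_scope.
Context {R : realType}.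

(** The preimage of each ray []r, +oo]] is an interval. *)
Lemma nonincreasing_emeasurable (D : set R) (f : R -> \bar R) :
  is_interval D ->
  (forall x y, D x -> D y -> (x <= y)%R -> f y <= f x) ->
  measurable_fun D f.
Proof.
move=> iD f_ni mD.
apply: (measurability _ (ErealGenOInfty.measurableE R)) => // _ [_ [r ->] <-].
apply: is_interval_measurable => s t /= [Ds fs] [Dt ft] u /andP[su ut].
have Du : D u by apply: (iD s t) => //; rewrite su.
split => //; move: fs ft; rewrite !in_itv/= !andbT => fs ft.
by apply: (lt_le_trans ft); exact: f_ni.
Qed.

End monotone_measurable.

(** * The density of the weight *)

Section telescoping.
Context {R : realType}.

(** Subdividing into [n.+1] equal steps bounds the total increment by [C / n.+1], for every [n]. It
    serves to compare the weight with the integral of its density through monotonicity of the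
    density alone. *)
Lemma increment_le_eq0 (D w : R -> R) (a b : R) : a <= b ->
  (forall x y, a <= x -> x <= y -> y <= b ->
     `|D y - D x| <= (w x - w y) * (y - x)) ->
  D a = D b.
Proof.
move=> ab Dw; apply/esym/eqP; rewrite -subr_eq0 -normr_le0.
pose C := (w a - w b) * (b - a).
suff H n : `|D b - D a| <= C / n.+1%:R.
  apply/ler_addgt0Pr => e e0; rewrite add0r.
  have [C0|C0] := leP C 0.
    by rewrite (le_trans (H 0)) ?divr1 ?(le_trans C0) ?ltW.
  rewrite (le_trans (H (Num.truncn (C / e))))//.
  rewrite ler_pdivrMr// mulrC -ler_pdivrMr//.
  by rewrite ltW// truncnS_gt.
(* over n+1 equal steps the bounds telescope *)
pose x i : R := a + i%:R * ((b - a) / n.+1%:R).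
have n0 : (n.+1%:R : R) != 0 by rewrite pnatr_eq0.
have h0 : 0 <= (b - a) / n.+1%:R by rewrite divr_ge0// subr_ge0.
have x0 : x 0 = a by rewrite /x mul0r addr0.
have xn : x n.+1 = b by rewrite /x mulrCA divff// mulr1 addrC subrK.
have xS i : x i.+1 - x i = (b - a) / n.+1%:R.
  by rewrite /x -natr1; ring.
have -> : D b - D a = \sum_(0 <= i < n.+1) (D (x i.+1) - D (x i)).
  by rewrite (telescope_sumr (fun i => D (x i)))// x0 xn.
have -> : C / n.+1%:R =
    \sum_(0 <= i < n.+1) ((w (x i) - w (x i.+1)) * ((b - a) / n.+1%:R)).
  rewrite -big_distrl/= -[X in _ = X * _]opprK -sumrN.
  under [X in _ = - X * _]eq_bigr do rewrite opprB.
  by rewrite (telescope_sumr (fun i => w (x i)))// x0 xn opprB mulrA.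
rewrite (le_trans (ler_norm_sum _ _ _))// !big_nat; apply: ler_sum => i /= iN.
rewrite -(xS i); apply: Dw.
- by rewrite /x lerDl mulr_ge0.
- by rewrite -subr_ge0 xS.
- rewrite -xn /x lerD2l ler_wpM2r// ler_nat ; exact: iN.
Qed.

End telescoping.

Section weight_density.
Context {R : realType} (phi : lorentz_weight R).
Local Notation mu := (@lebesgue_measure R).

(** Concavity at [b], written as the convex combination of [v] and [a] in which [v] has coefficient
    [(b - a) / (v - a)]. *)
Lemma weight_chord (a b v : R) : 0 <= a -> a < b -> b < v -> v <= 1 ->
  (phi v - phi b) / (v - b) <= (phi b - phi a) / (b - a).
Proof.
move=> a0 ab bv v1; have av := lt_trans ab bv.
have va0 : 0 < v - a by rewrite subr_gt0.
have q0 : 0 <= (b - a) / (v - a) by rewrite divr_ge0// subr_ge0 ltW.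
have q1 : (b - a) / (v - a) <= 1.
  by rewrite ler_pdivrMr// mul1r lerD2r ltW.
have qi : Itv.spec (Itv.num_sem (R:=R)) (Itv.Real `[0%Z, 1%Z]) ((b - a) / (v - a)).
  by apply/and3P; split; rewrite /= ?num_real// in_itv/= q0 q1.
have := @weight_concave _ phi (Itv.mk qi) v a.
rewrite !inE/= !in_itv/= a0 v1 (le_trans a0 (ltW av)).
rewrite (le_trans (ltW av) v1) => /(_ isT isT).
rewrite !convRE /conv/= /GRing.scale/=.
set q := _ / _; rewrite [X in phi X](_ : _ = b); last first.
  by rewrite /q /unstable.onem; field; rewrite gt_eqF.
move=> H; rewrite ler_pdivrMr ?subr_gt0// mulrAC ler_pdivlMr ?subr_gt0//.
have : (v - a) * - phi b <= (v - a) * (q * - phi v + unstable.onem q * - phi a).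
  by rewrite ler_pM2l.
have -> : (v - a) * (q * - phi v + unstable.onem q * - phi a) =
   - ((b - a) * phi v + (v - b) * phi a).
  by rewrite /q /unstable.onem; field; rewrite gt_eqF.
by lra.
Qed.

(* [weight_density] is the right derivative of the weight on ]0,1[, since the
   slopes decrease; at 1 it is [sup set0 = 0]. *)
Definition weight_slopes (t : R) : set R :=
  [set (phi v - phi t) / (v - t) | v in `]t, 1]].

Definition weight_density (t : R) : R :=
  if 0 < t <= 1 then sup (weight_slopes t) else 0.

Lemma weight_le (s t : R) : 0 <= s -> s <= t -> t <= 1 -> phi s <= phi t.
Proof.
move=> s0 st t1; apply: weight_nondecreasing => //; rewrite in_itv/= ?s0 ?t1 ?andbT.
  exact: le_trans t1.
exact: le_trans st.
Qed.

Lemma weight_density_le_chord (a b : R) : 0 <= a -> a < b -> b <= 1 ->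
  weight_density b <= (phi b - phi a) / (b - a).
Proof.
move=> a0 ab b1; rewrite /weight_density (le_lt_trans a0 ab) b1/=.
(* The set of slopes is empty at [b = 1]; the density is then [sup set0 = 0], below the chord slope
   because [phi] is nondecreasing. *)
have [->|/set0P sne] := eqVneq (weight_slopes b) set0.
  by rewrite sup0 divr_ge0// subr_ge0 ?weight_le// ltW.
by apply: ge_sup => // _ [v /=] /[1!in_itv]/= /andP[bv v1] <-; exact: weight_chord.
Qed.

(** Since [a > 0], the slope of the chord over [[0, a]] bounds all slopes at [a] from above, so
    their supremum is a genuine one. *)
Lemma chord_le_weight_density (a b : R) : 0 < a -> a < b -> b <= 1 ->
  (phi b - phi a) / (b - a) <= weight_density a.
Proof.
move=> a0 ab b1; rewrite /weight_density a0 (ltW (lt_le_trans ab b1))/=.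
apply: ub_le_sup; last by exists b => //=; rewrite in_itv/= ab.
exists ((phi a - phi 0) / (a - 0)) => _ [v /=] /[1!in_itv]/= /andP[av v1] <-.
exact: weight_chord.
Qed.

Lemma weight_density_ge0 (t : R) : 0 <= weight_density t.
Proof.
rewrite /weight_density; case: ifPn => // /andP[t0 t1].
move: t1; rewrite le_eqVlt => /predU1P[->|t1].
  suff -> : weight_slopes 1 = set0 by rewrite sup0.
  rewrite -subset0 => z [v /=].
  by rewrite in_itv/= => /andP[v1]; rewrite leNgt v1.
have := chord_le_weight_density t0 t1 (lexx 1).
rewrite /weight_density t0 (ltW t1)/=; apply: le_trans.
by rewrite divr_ge0// subr_ge0 ?weight_le// ltW.
Qed.

Lemma weight_density_le (a b : R) : 0 < a -> a <= b -> b <= 1 ->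
  weight_density b <= weight_density a.
Proof.
move=> a0; rewrite le_eqVlt => /predU1P[->//|ab] b1.
apply: (le_trans (weight_density_le_chord (ltW a0) ab b1)).
exact: chord_le_weight_density.
Qed.

Lemma measurable_weight_density : measurable_fun setT weight_density.
Proof.
have -> : weight_density = weight_density \_ `]0, 1].
  apply/funext => t; rewrite patchE; case: ifPn => //.
  by rewrite notin_setE/= in_itv/= /weight_density => /negP/negbTE ->.
apply: (measurable_restrictT weight_density (measurable_itv `]0, 1])).1.
apply/measurable_EFinP.
apply: nonincreasing_emeasurable; first exact: interval_is_interval.
move=> x y /=; rewrite !in_itv/= => /andP[x0 x1] /andP[y0 y1] xy.
by rewrite lee_fin weight_density_le.
Qed.

(** The increment of [phi] over [[x, y]] and the integral of the density there both lie between
    [weight_density y * (y - x)] and [weight_density x * (y - x)], so [increment_le_eq0] applies to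
    their difference. *)
Lemma integral_weight_density_pos (a b : R) : 0 < a -> a <= b -> b <= 1 ->
  (\int[mu]_(t in `]a, b]) (weight_density t)%:E)%E = (phi b - phi a)%:E.
Proof.
move=> a0 ab b1.
pose I x y := (\int[mu]_(t in `]x, y]) (weight_density t)%:E)%E.
have mw D : measurable_fun D (fun t => (weight_density t)%:E).
  by apply: measurable_funTS; apply/measurable_EFinP; exact: measurable_weight_density.
have len (x y : R) : x <= y -> mu `]x, y] = (y - x)%:E.
  move=> xy; rewrite lebesgue_measure_itv/= lte_fin -EFinD.
  by move: xy; rewrite le_eqVlt => /predU1P[->|->//]; rewrite ltxx subrr.
have Ile x y : a <= x -> x <= y -> y <= b ->
    (I x y <= (weight_density x * (y - x))%:E)%E.
  move=> ax xy yb; rewrite EFinM -len// -integral_cst//.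
  apply: ge0_le_integral => //=.
  - by move=> t _; rewrite lee_fin weight_density_ge0.
  - exact: mw.
  - move=> t ti; have : (t : R) \in `]x, y] by [].
    rewrite in_itv/= lee_fin => /andP[xt ty].
    by rewrite weight_density_le// ?(lt_le_trans a0)// ?(ltW xt)// (le_trans ty)//
      (le_trans yb).
have Ige x y : a <= x -> x <= y -> y <= b ->
    ((weight_density y * (y - x))%:E <= I x y)%E.
  move=> ax xy yb; rewrite EFinM -len// -integral_cst//.
  apply: ge0_le_integral => //=.
  - by move=> t _; rewrite lee_fin weight_density_ge0.
  - exact: mw.
  - move=> t ti; have : (t : R) \in `]x, y] by [].
    rewrite in_itv/= lee_fin => /andP[xt ty].
    by rewrite weight_density_le// ?(le_trans yb)// (lt_trans _ xt)// (lt_le_trans a0).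
have Ifin x y : a <= x -> x <= y -> y <= b -> I x y \is a fin_num.
  move=> ax xy yb; rewrite ge0_fin_numE.
    by rewrite (le_lt_trans (Ile _ _ ax xy yb))// ltry.
  by apply: integral_ge0 => t _; rewrite lee_fin weight_density_ge0.
have Iadd x y : a <= x -> x <= y -> y <= b -> I a y = (I a x + I x y)%E.
  move=> ax xy yb; rewrite /I -ge0_integral_setU//=.
  - by rewrite -itv_bndbnd_setU// bnd_simp.
  - exact: mw.
  - by move=> t _; rewrite lee_fin weight_density_ge0.
  - apply/disj_setPS => t [] /=; rewrite !in_itv/= => /andP[_ tx] /andP[xt _].
    by move: xt; rewrite ltNge tx.
pose D x := phi x - fine (I a x).
have : D a = D b.
  apply: (@increment_le_eq0 _ _ weight_density) => // x y ax xy yb.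
  have -> : D y - D x = (phi y - phi x) - fine (I x y).
    rewrite /D (Iadd x y)// fineD ?Ifin//; first by ring.
    exact: le_trans yb.
  have x0 := lt_le_trans a0 ax.
  have y1 := le_trans yb b1.
  have H1 : fine (I x y) <= weight_density x * (y - x).
    by rewrite -lee_fin fineK ?Ifin// Ile.
  have H2 : weight_density y * (y - x) <= fine (I x y).
    by rewrite -lee_fin fineK ?Ifin// Ige.
  move: xy; rewrite le_eqVlt => /predU1P[xy|xy].
    move: H1 H2; rewrite xy !subrr !mulr0 => H1 H2.
    by rewrite sub0r normrN ger0_norm.
  have := weight_density_le_chord (ltW x0) xy y1.
  have := chord_le_weight_density x0 xy y1.
  rewrite ler_pdivrMr ?subr_gt0// ler_pdivlMr ?subr_gt0// => H3 H4.
  by rewrite ler_norml; apply/andP; split; lra.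
rewrite /D {1}/I set_itvoc0 integral_set0/= subr0 => ->.
by rewrite opprB addrC subrK fineK// Ifin.
Qed.

(** The density may be unbounded near 0. The case [a = 0] is the limit of the integrals over []b /
    n.+1, b]], by monotone convergence on one side and [weight_cvg0] on the other. *)
Lemma integral_weight_density (a b : R) : 0 <= a -> a <= b -> b <= 1 ->
  (\int[mu]_(t in `]a, b]) (weight_density t)%:E)%E = (phi b - phi a)%:E.
Proof.
rewrite le_eqVlt => /predU1P[<-|]; last exact: integral_weight_density_pos.
rewrite le_eqVlt => /predU1P[<- _|b0 b1].
  by rewrite set_itvoc0 integral_set0 subrr.
rewrite weight0 subr0.
pose F n : set R := `]b / n.+1%:R, b]%classic.
have Fb : `]0, b]%classic = \bigcup_n F n.
  apply/seteqP; split => t /=.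
    rewrite in_itv/= => /andP[t0 tb].
    exists (Num.truncn (b / t)) => //=.
    rewrite /F/= in_itv/= tb andbT ltr_pdivrMr// mulrC -ltr_pdivrMr//.
    exact: truncnS_gt.
  move=> [n _]; rewrite /F/= !in_itv/= => /andP[bt ->]; rewrite andbT.
  by rewrite (lt_trans _ bt)// divr_gt0.
have mw D : measurable_fun D (fun t => (weight_density t)%:E).
  by apply: measurable_funTS; apply/measurable_EFinP; exact: measurable_weight_density.
have : (\int[mu]_(t in F n) (weight_density t)%:E @[n --> \oo] -->
    \int[mu]_(t in `]0%R, b]) (weight_density t)%:E)%E.
  rewrite Fb; apply: ge0_nondecreasing_set_cvg_integral => //.
  - move=> n m nm; rewrite subsetEset => t; rewrite /F/= !in_itv/=.
    move=> /andP[+ ->]; rewrite andbT; apply: le_lt_trans.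
    by rewrite ler_pM2l// lef_pV2 ?posrE// ler_nat.
  - by move=> n; exact: measurable_itv.
  - by move=> n; exact: mw.
  - by move=> n t _; rewrite lee_fin weight_density_ge0.
move/cvg_lim => <- //; apply/cvg_lim => //.
have -> : (fun n => \int[mu]_(t in F n) (weight_density t)%:E)%E =
    (fun n => (phi b - phi (b / n.+1%:R))%:E).
  apply/funext => n; rewrite integral_weight_density_pos ?divr_gt0//.
  by rewrite ler_pdivrMr// ler_peMr ?ler1n// ltW.
apply: cvg_EFin; first exact: nearW.
rewrite -[X in _ --> X]subr0; apply: cvgB; first exact: cvg_cst.
have /cvg_at_rightP := @weight_cvg0 _ phi; apply.
split; first by move=> n; rewrite divr_gt0.
rewrite -[X in _ --> X](mulr0 b); apply: cvgM; first exact: cvg_cst.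
exact: cvg_harmonic.
Qed.

End weight_density.

(** * The Stieltjes measure of the weight and its derivative almost everywhere *)

Section weight_measure.
Local Open Scope ereal_scope.
Context {R : realType} (phi : lorentz_weight R).
Local Notation mu := (@lebesgue_measure R).
Local Notation w := (weight_density phi).

Lemma emeasurable_weight_density (D : set R) :
  measurable_fun D (fun t => (w t)%:E).
Proof.
apply: measurable_funTS; apply/measurable_EFinP.
exact: measurable_weight_density.
Qed.

Definition weight_measure (B : set (measurableTypeR R)) : \bar R :=
  \int[mu]_(t in B) (w t)%:E.

Let weight_measure0 : weight_measure set0 = 0.
Proof. by rewrite /weight_measure integral_set0. Qed.

Let weight_measure_ge0 B : 0 <= weight_measure B.
Proof. by apply: integral_ge0 => t _; rewrite lee_fin weight_density_ge0. Qed.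

Let weight_measure_sigma_additive : semi_sigma_additive weight_measure.
Proof.
move=> F mF tF mUF; rewrite /weight_measure; apply: cvg_toP.
  apply: ereal_nondecreasing_is_cvgn => m n mn.
  by apply: lee_sum_nneg_natr => // k _ _; exact: weight_measure_ge0.
rewrite ge0_integral_bigcup//=.
- exact: emeasurable_weight_density.
- by move=> t _; rewrite lee_fin weight_density_ge0.
Qed.

HB.instance Definition _ := isMeasure.Build _ _ _ weight_measure
  weight_measure0 weight_measure_ge0 weight_measure_sigma_additive.

(** By uniqueness of the Stieltjes measure it suffices to treat intervals []x, y]], where the claim
    is the formula for the increments of [phi] between the clamped end points. *)
Lemma lebesgue_stieltjes_weightE (B : set R) : measurable B ->
  lebesgue_stieltjes_measure (weight_ext phi) B = \int[mu]_(t in B) (w t)%:E.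
Proof.
move=> mB; rewrite -[RHS]/(weight_measure B).
apply: lebesgue_stieltjes_measure_unique => // X /ocitvP[->|[[x y]/= xy ->]].
  by rewrite !measure0.
rewrite /lebesgue_stieltjes_measure/= /measure_extension measurable_mu_extE/=;
  last exact: is_ocitv.
rewrite wlength_itv_bnd; last exact: ltW.
pose cl (t : R) := Num.max 0%R (Num.min t 1%R).
have clxy : (cl x <= cl y)%R.
  rewrite /cl ge_max le_max lexx/= le_max; apply/orP; right.
  by rewrite le_min !ge_min (ltW xy)/= lexx orbT.
rewrite -[weight_ext phi y]/(phi (cl y)) -[weight_ext phi x]/(phi (cl x)).
rewrite -integral_weight_density//; last 2 first.
- by rewrite /cl le_max lexx.
- by rewrite /cl ge_max ler01/= ge_min lexx orbT.
rewrite /weight_measure [LHS]integral_mkcond [RHS]integral_mkcond.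
apply: eq_integral => t _; rewrite !patchE.
(* The density vanishes off []0, 1]], and for [t] in []0, 1]] clamping [x] and [y] does not change
   their comparison with [t]. *)
have [t01|t01] := boolP (0 < t <= 1)%R; last first.
  by rewrite /weight_density (negbTE t01); case: ifP; case: ifP.
congr (if _ then _ else _).
move: t01 => /andP[t0 t1]; apply/idP/idP; rewrite !inE/= !in_itv/= /cl.
  rewrite gt_max t0/= gt_min le_max (leNgt t 0%R) t0/= le_min t1 andbT.
  by rewrite (ltNge 1%R t) t1 orbF.
rewrite gt_max t0/= gt_min le_max (leNgt t 0%R) t0/= le_min t1 andbT.
by rewrite (ltNge 1%R t) t1 orbF.
Qed.

(** Lebesgue differentiation on each []c n, 1[], where [phi - phi (c n)] is a primitive of the
    density; countably many of these intervals exhaust []0, 1[]. *)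
Lemma derive1_weight_ae :
  {ae mu, forall t, t \in `]0%R, 1%R[ -> derive1 phi t = w t}.
Proof.
pose c n : R := (n.+2%:R^-1)%R.
have c0 n : (0 < c n)%R by rewrite invr_gt0.
have c1 n : (c n <= 1)%R by rewrite invf_le1// ler1n.
suff : {ae mu, forall t, forall n : nat, (c n < t < 1)%R -> derive1 phi t = w t}.
  apply: (@filterS _ _ (ae_filter_ringOfSetsType mu)) => t H.
  rewrite in_itv/= => /andP[t0 t1].
  apply: (H (Num.truncn t^-1)); rewrite t1 andbT /c invf_plt ?posrE//.
  by rewrite (lt_trans (truncnS_gt _))// ltr_nat.
apply/ae_foralln => n.
pose f := w \_ `]c n, 1%R].
have mf : measurable_fun setT (EFin \o f).
  apply/measurable_EFinP.
  apply: (measurable_restrictT w (measurable_itv `]c n, 1%R])).1.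
  by apply: measurable_funTS; exact: measurable_weight_density.
have f0 t : (0 <= f t)%R.
  by rewrite /f patchE; case: ifPn => // _; exact: weight_density_ge0.
have intf : mu.-integrable setT (EFin \o f).
  apply/integrableP; split => //.
  under eq_integral => t _ do rewrite gee0_abs ?lee_fin//.
  rewrite (_ : \int[mu]_t _ = \int[mu]_(t in `]c n, 1%R]) (w t)%:E).
    by rewrite integral_weight_density ?ltry// ltW.
  rewrite [RHS]integral_mkcond; apply: eq_integral => t _.
  by rewrite /f/= !patchE; case: ifPn.
have locf : locally_integrable setT f.
  by have := integrable_locally measurableT intf; rewrite patch_setT.
have : forall y,
    mu.-integrable [set` Interval (BRight (c n)) (BRight y)] (EFin \o f).
  by move=> y; exact: integrableS intf.
move=> /FTC1 /(_ locf)/=.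
apply: (@filterS _ _ (ae_filter_ringOfSetsType mu)) => t H /andP[ct t1].
have := H ct => -[_].
rewrite /f patchE mem_set; last by rewrite /= in_itv/= ct ltW.
move=> <-; rewrite !derive1E; apply/esym.
transitivity ('D_1%R (fun x => (phi x - phi (c n))%R) t); last first.
  rewrite /derive; set F := (X in lim (X @ _)); set G := (X in _ = lim (X @ _)).
  suff -> : F = G by [].
  by apply/funext => h /=; congr (_ *: _)%R; rewrite opprB addrA subrK.
apply: near_eq_derive; near=> x.
have cx : (c n < x)%R by near: x; exact: lt_nbhsr.
have x1 : (x < 1)%R by near: x; exact: lt_nbhsl.
rewrite /Rintegral (_ : \int[mu]_(t in _) _ = \int[mu]_(t in `]c n, x]) (w t)%:E).
  by rewrite integral_weight_density//; exact: ltW.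
apply: eq_integral => y; rewrite inE/= in_itv/= => /andP[cy yx].
by rewrite /f patchE mem_set//= in_itv/= cy (le_trans yx)// ltW.
Unshelve. all: by end_near. Qed.

End weight_measure.

(** * Rearrangements and Lorentz norms *)

Section lorentz_norm.
Local Open Scope ereal_scope.
Context {R : realType}.
Implicit Types (phi : lorentz_weight R) (f g : R -> R).
Local Notation mu := (@lebesgue_measure R).
Local Notation w := weight_density.

Lemma rearrangement_ge0 f s : 0 <= rearrangement f s.
Proof. by apply/ereal_infP => _ [tau [tau0 _] <-]; rewrite lee_fin. Qed.

Lemma rearrangement_nonincreasing f s t : (s <= t)%R ->
  rearrangement f t <= rearrangement f s.
Proof.
move=> st; apply/ereal_infP => _ [tau [tau0 ft] <-].
apply: ereal_inf_lbound; exists tau => //.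
by split => //; apply: (le_trans ft); rewrite lee_fin.
Qed.

Lemma measurable_rearrangement f (D : set R) : measurable D ->
  measurable_fun D (rearrangement f).
Proof.
move=> mD; apply: (measurable_funS measurableT) => //.
apply: nonincreasing_emeasurable => // x y _ _.
exact: rearrangement_nonincreasing.
Qed.

(** Apply the layer cake formula on both sides: the superlevel sets of [g] have the same mass under
    the Stieltjes measure and under [w dt]. *)
Lemma integral_weight_measure phi (D : set R) (g : R -> \bar R) :
  measurable D -> measurable_fun D g -> (forall t, D t -> 0 <= g t) ->
  \int[lebesgue_stieltjes_measure (weight_ext phi)]_(t in D) g t =
  \int[mu]_(t in D) ((w phi t)%:E * g t).
Proof.
move=> mD mg g0.
have w0 t : D t -> 0 <= (w phi t)%:E by rewrite lee_fin weight_density_ge0.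
rewrite (weighted_layer_cake mu mD mg (emeasurable_weight_density phi (D := D)) g0 w0).
pose nu := lebesgue_stieltjes_measure (weight_ext phi).
transitivity (\int[nu]_(t in D) (cst 1 t * g t)).
  by apply: eq_integral => t _; rewrite mul1e.
rewrite (weighted_layer_cake nu mD mg (measurable_cst _) g0 (fun _ _ => lee01)).
apply: eq_integral => u _.
have mE : measurable (D `&` [set x | u%:E < g x]).
  exact: emeasurable_fun_o_infty.
rewrite (integral_cst nu mE) mul1e; exact: lebesgue_stieltjes_weightE.
Qed.

Lemma lorentz_normE phi f : lorentz_norm phi f =
  \int[mu]_(s in `[0%R, 1%R]) ((w phi s)%:E * rearrangement f s).
Proof.
apply: integral_weight_measure => //.
- exact: measurable_rearrangement.
- by move=> t _; exact: rearrangement_ge0.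
Qed.

(** [derive1 phi] is known only almost everywhere, so the two integrands are compared under the
    completed measure. *)
Lemma integral_derive1_weight phi (b : R) (h : R -> R) : (b <= 1)%R ->
  measurable_fun `]0%R, b[ h ->
  (forall t, t \in `]0%R, b[ -> 0 <= h t)%R ->
  lebesgue_integral `]0%R, b[ (fun t => (h t * derive1 phi t)%:E) =
  \int[mu]_(t in `]0%R, b[) ((w phi t)%:E * (h t)%:E).
Proof.
move=> b1 mh h0.
have mhw : measurable_fun `]0%R, b[ (fun t => (w phi t)%:E * (h t)%:E).
  by apply: emeasurable_funM; [exact: emeasurable_weight_density|exact/measurable_EFinP].
rewrite -ge0_lebesgue_integralE//; last first.
  by move=> t tb; rewrite mule_ge0// lee_fin ?h0// weight_density_ge0.
have mhw' := measurable_fun_lebesgue (measurable_itv `]0%R, b[) mhw.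
have ae_hw : ae_eq (@completed_lebesgue_measure R) (`]0%R, b[%classic : set lebesgueR)
    (fun t => (w phi t)%:E * (h t)%:E) (fun t => (h t * derive1 phi t)%:E).
  have [N [mN N0 subN]] := derive1_weight_ae phi.
  exists N; split => //.
    exact: measurable_lebesgue.
  move=> t /= Ht; apply: subN => /= Hphi; apply: Ht => tb.
  rewrite Hphi; first by rewrite EFinM muleC.
  by move: tb; rewrite !in_itv/= => /andP[-> tb]; exact: lt_le_trans b1.
have mI := measurable_lebesgue (measurable_itv `]0%R, b[).
(* Completeness makes the integrand with [derive1 phi] measurable, as it is almost everywhere equal
   to a measurable one. *)
have mdh := ae_measurable_fun (@completed_lebesgue_measure_is_complete R)
  ae_hw mhw'.
apply/esym; apply: ae_eq_integral; [exact: mI|exact: mhw'|exact: mdh|].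
exact: ae_hw.
Qed.

End lorentz_norm.

(** * Estimates of rearrangements, truncation at a level and Hardy's lemma *)

Section rearrangement.
Local Open Scope ereal_scope.
Context {R : realType}.
Implicit Types (f : R -> R).
Local Notation mu := (@lebesgue_measure R).
Local Notation cmu := (@completed_lebesgue_measure R).

(** On every set, measurable or not, [mu] is by definition the outer measure, which is monotone. The
    completed measure is the same outer measure, so that [distribution01] can be computed with
    [mu]. *)
Lemma le_lebesgue_measure (A B : set R) : A `<=` B -> mu A <= mu B.
Proof.
exact: (@le_outer_measure R _ ((wlength (@idfun R))^*)%mu).
Qed.

Lemma distribution01E f tau : distribution01 f tau =
  mu (`[0%R, 1%R] `&` [set x | (tau < `|f x|)%R]).
Proof. by []. Qed.

Lemma distribution01_le1 f tau : distribution01 f tau <= 1.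
Proof.
rewrite distribution01E; apply: (@le_trans _ _ (mu `[0%R, 1%R])).
  by apply: le_lebesgue_measure => x [].
by rewrite lebesgue_measure_itv/= lte01 oppr0 adde0.
Qed.

Lemma lt_rearrangement f (s tau : R) : (0 <= tau)%R ->
  tau%:E < rearrangement f s -> s%:E < distribution01 f tau.
Proof.
move=> tau0; apply: contraTT; rewrite -!leNgt => ds.
by apply: ereal_inf_lbound; exists tau.
Qed.

Lemma rearrangement_le f (a b s v : R) : (0 <= v)%R -> (a <= b)%R ->
  (b - a <= s)%R ->
  (forall x, x \in `[0%R, 1%R] -> v < `|f x| -> a <= x <= b)%R ->
  rearrangement f s <= v%:E.
Proof.
move=> v0 ab bas H; apply: ereal_inf_lbound; exists v => //; split => //.
rewrite distribution01E (@le_trans _ _ (mu `[a, b]))//.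
  by apply: le_lebesgue_measure => x [/= x01 /(H _ x01)]; rewrite in_itv.
rewrite lebesgue_measure_itv/= lte_fin -EFinB.
by case: ifPn => _; rewrite lee_fin// (le_trans _ bas)// subr_ge0.
Qed.

(** If the superlevel set at [tau] contains an interval longer than [s], then [tau] is not among the
    levels whose infimum defines the rearrangement. *)
Lemma rearrangement_ge f (s : R) (v : \bar R) :
  (forall tau : R, (0 <= tau)%R -> tau%:E < v -> exists a b,
    [/\ (a <= b)%R, (s < b - a)%R &
      (forall x, a <= x <= b -> 0 <= x <= 1 /\ tau < `|f x|)%R]) ->
  v <= rearrangement f s.
Proof.
move=> H; apply/ereal_infP => _ [tau [tau0 ft] <-].
rewrite leNgt; apply/negP => /(H _ tau0) [a [b [ab sab fab]]].
move: ft; rewrite leNgt => /negP; apply.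
rewrite distribution01E (@lt_le_trans _ _ (mu `[a, b]))//.
  rewrite lebesgue_measure_itv/= lte_fin -EFinB.
  case: ifPn => [_|]; first by rewrite lte_fin.
  rewrite -leNgt => ba; have := sab.
  by rewrite lte_fin (_ : b - a = 0)%R//; apply/eqP; rewrite subr_eq0 eq_le ba.
apply: le_lebesgue_measure => x /=; rewrite !in_itv/= => /fab[x01 tx].
by split => //=; rewrite in_itv.
Qed.

(* The easy half of the formula for Peetre's K-functional between L^1 and
   L^infty. *)
Lemma integral_rearrangement_le f (s tau0 : R) :
  measurable_fun (`[0%R, 1%R]%classic : set R) f -> (0 <= s <= 1)%R -> (0 <= tau0)%R ->
  \int[mu]_(t in `]0%R, s]) rearrangement f t <=
  (s * tau0)%:E + \int[mu]_(x in `[0%R, 1%R]) (Num.max (`|f x| - tau0) 0)%:E.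
Proof.
move=> mf /andP[s0 s1] tau00.
pose g t := maxe (rearrangement f t - tau0%:E) 0.
have mr D : measurable D -> measurable_fun D (rearrangement f).
  exact: measurable_rearrangement.
have mI : measurable (`]0%R, s]%classic : set R) by exact: measurable_itv.
have mJ : measurable (`[0%R, 1%R]%classic : set R) by exact: measurable_itv.
have mg : measurable_fun `]0%R, s] g.
  apply: measurable_maxe; last exact: measurable_cst.
  by apply: emeasurable_funB; [exact: mr|exact: measurable_cst].
have g0 t : 0 <= g t by rewrite le_max lexx orbT.
apply: (@le_trans _ _ (\int[mu]_(t in `]0%R, s]) (cst tau0%:E t + g t))).
  apply: ge0_le_integral => //.
  - by move=> t _; exact: rearrangement_ge0.
  - exact: mr.
  - by apply: emeasurable_funD => //; exact: measurable_cst.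
  - move=> t _ /=; rewrite -leeBlDl// /g.
    by rewrite le_max lexx.
rewrite ge0_integralD//.
apply: leeD.
  rewrite [leLHS](integral_cst mu mI) [X in _ * X <= _]lebesgue_measure_itv/= lte_fin.
  case: ifPn => [_|]; first by rewrite sube0 -EFinM mulrC.
  by rewrite mule0 lee_fin mulr_ge0.
pose h x := (Num.max (`|f x| - tau0) 0)%:E.
have mh : measurable_fun (`[0%R, 1%R]%classic : set R) h.
  apply/measurable_EFinP; apply: measurable_maxr; last exact: measurable_cst.
  apply: measurable_funB; last exact: measurable_cst.
  exact: measurableT_comp.
have h0 x : 0 <= h x by rewrite lee_fin le_max lexx orbT.
have -> : \int[mu]_(t in `]0%R, s]) g t = \int[mu]_(t in `]0%R, s]) (cst 1 t * g t).
  by apply: eq_integral => t _; rewrite mul1e.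
have -> : \int[mu]_(t in `[0%R, 1%R]) h t = \int[mu]_(t in `[0%R, 1%R]) (cst 1 t * h t).
  by apply: eq_integral => t _; rewrite mul1e.
rewrite (weighted_layer_cake mu mI mg (measurable_cst _) (fun t _ => g0 t) (fun _ _ => lee01)).
rewrite (weighted_layer_cake mu mJ mh (measurable_cst _) (fun t _ => h0 t) (fun _ _ => lee01)).
have mIg u : measurable (`]0%R, s] `&` [set x | u%:E < g x]).
  exact: emeasurable_fun_o_infty.
have mJh u : measurable (`[0%R, 1%R] `&` [set x | u%:E < h x]).
  exact: emeasurable_fun_o_infty.
have -> : \int[mu]_(u in `[0%R, +oo[) \int[mu]_(x in `]0%R, s] `&` [set x | u%:E < g x]) cst 1 x
  = \int[mu]_(u in `[0%R, +oo[) mu (`]0%R, s] `&` [set x | u%:E < g x]).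
  by apply: eq_integral => u _; rewrite (integral_cst mu (mIg u)) mul1e.
have -> : \int[mu]_(u in `[0%R, +oo[) \int[mu]_(x in `[0%R, 1%R] `&` [set x | u%:E < h x]) cst 1 x
  = \int[mu]_(u in `[0%R, +oo[) mu (`[0%R, 1%R] `&` [set x | u%:E < h x]).
  by apply: eq_integral => u _; rewrite (integral_cst mu (mJh u)) mul1e.
have ni (D : set R) (k : R -> \bar R) : measurable_fun (`[0%R, +oo[%classic : set R)
    (fun u => mu (D `&` [set x | u%:E < k x])).
  apply: nonincreasing_emeasurable; first exact: interval_is_interval.
  move=> u v _ _ uv; apply: le_lebesgue_measure => x [Dx /= vk]; split => //=.
  by apply: le_lt_trans vk; rewrite lee_fin.
apply: ge0_le_integral => //; [exact: ni|exact: ni|].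
move=> u; rewrite /= in_itv/= andbT => u0.
have -> : mu (`[0%R, 1%R] `&` [set x | u%:E < h x]) = distribution01 f (u + tau0).
  rewrite distribution01E; congr (mu _); congr (_ `&` _).
  apply/funext => x; apply/propext => /=.
  by rewrite /h lte_fin lt_max (ltNge u 0%R) u0 orbF ltrBrDr.
set d := distribution01 _ _.
have dfin : d \is a fin_num.
  rewrite ge0_fin_numE; first exact: (le_lt_trans (distribution01_le1 _ _) (ltry 1)).
  by rewrite /d distribution01E; exact: measure_ge0.
(* Level by level: if [g t > u], then the rearrangement at [t] exceeds [u + tau0], hence [t < d]; so
   the superlevel set of [g] has measure at most [d]. *)
apply: (@le_trans _ _ (mu `]0%R, fine d])).
  apply: le_lebesgue_measure => t [/=]; rewrite !in_itv/= => /andP[t0 _].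
  rewrite t0/= /g lt_max (ltNge u%:E 0) lee_fin u0 orbF.
  rewrite lteBrDr// -EFinD => /lt_rearrangement => /(_ (addr_ge0 u0 tau00)) td.
  by rewrite -lee_fin fineK// ltW.
rewrite lebesgue_measure_itv/= lte_fin; case: ifPn => _.
  by rewrite sube0 fineK.
by rewrite /d distribution01E; exact: measure_ge0.
Qed.

(* Hardy's lemma: the superlevel sets of the density are initial intervals. *)
Lemma weight_density_integral_le (phi : lorentz_weight R) (g h : R -> \bar R) :
  measurable_fun (`]0%R, 1%R]%classic : set R) g ->
  measurable_fun (`]0%R, 1%R]%classic : set R) h ->
  (forall t, t \in `]0%R, 1%R] -> 0 <= g t) ->
  (forall t, t \in `]0%R, 1%R] -> 0 <= h t) ->
  (forall s, (0 <= s <= 1)%R ->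
    \int[mu]_(t in `]0%R, s]) g t <= \int[mu]_(t in `]0%R, s]) h t) ->
  \int[mu]_(t in `]0%R, 1%R]) ((weight_density phi t)%:E * g t) <=
  \int[mu]_(t in `]0%R, 1%R]) ((weight_density phi t)%:E * h t).
Proof.
move=> mg mh g0 h0 gh.
have mI : measurable (`]0%R, 1%R]%classic : set R) by exact: measurable_itv.
pose w t := (weight_density phi t)%:E.
have mw D : measurable_fun D w by exact: emeasurable_weight_density.
have w0 t : 0 <= w t by rewrite lee_fin weight_density_ge0.
have cake k : measurable_fun (`]0%R, 1%R]%classic : set R) k ->
    (forall t, t \in `]0%R, 1%R] -> 0 <= k t) ->
    \int[mu]_(t in `]0%R, 1%R]) (w t * k t) =
    \int[mu]_(u in `[0%R, +oo[)
      \int[mu]_(t in `]0%R, 1%R] `&` [set x | u%:E < w x]) k t.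
  move=> mk k0; rewrite -(weighted_layer_cake mu mI (mw _) mk)//.
  by apply: eq_integral => t _; rewrite muleC.
rewrite !cake//.
have mE u : measurable (`]0%R, 1%R] `&` [set x | u%:E < w x]).
  exact: emeasurable_fun_o_infty.
have ni k : measurable_fun (`]0%R, 1%R]%classic : set R) k ->
    (forall t, t \in `]0%R, 1%R] -> 0 <= k t) ->
  measurable_fun (`[0%R, +oo[%classic : set R)
   (fun u => \int[mu]_(t in `]0%R, 1%R] `&` [set x | u%:E < w x]) k t).
  move=> mk k0; apply: nonincreasing_emeasurable; first exact: interval_is_interval.
  move=> u v _ _ uv; apply: ge0_subset_integral => //.
  - exact: mE.
  - exact: mE.
  - by apply: (measurable_funS mI) => // x [].
  - by move=> t [/= /k0].
  - move=> x [Dx /= vk]; split => //=.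
    by apply: le_lt_trans vk; rewrite lee_fin.
apply: ge0_le_integral => //.
- by move=> u _; apply: integral_ge0 => t [/= /g0].
- exact: ni.
- exact: ni.
move=> u _; set E := _ `&` _.
(* The set [E] is closed downwards in []0, 1]]: with [s = sup E] it is []0, s]] or []0, s[], which
   give the same integrals; [s = 0] serves for the empty set. *)
have [s s01 Es] : exists2 s, (0 <= s <= 1)%R &
    forall k, measurable_fun (`]0%R, 1%R]%classic : set R) k ->
     \int[mu]_(t in E) k t = \int[mu]_(t in `]0%R, s]) k t.
  have [E0|/set0P[e Ee]] := eqVneq E set0.
    exists 0%R; first by rewrite lexx ler01.
    by move=> k _; rewrite E0 set_itvoc0.
  have E1 : ubound E 1%R by move=> x [/=]; rewrite in_itv/= => /andP[].
  have Edown x y : E x -> (0 < y <= x)%R -> E y.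
    move=> [/=]; rewrite in_itv/= => /andP[x0 x1] ux /andP[y0 yx]; split => /=.
      by rewrite in_itv/= y0 (le_trans yx).
    by apply: (lt_le_trans ux); rewrite lee_fin weight_density_le.
  have hsE : has_sup E by split; [exists e|exists 1%R].
  have s1 : (sup E <= 1)%R by apply: ge_sup => //; exists e.
  have E0 x : E x -> (0 < x)%R by move=> [/=]; rewrite in_itv/= => /andP[].
  have s0 : (0 < sup E)%R.
    by apply: (lt_le_trans (E0 _ Ee)); apply: ub_le_sup => //; exists 1%R.
  exists (sup E); first by rewrite ltW.
  move=> k mk; have [sE|sE] := pselect (E (sup E)).
    congr (integral _ _ _); apply/seteqP; split => x /=; rewrite in_itv/=.
      by move=> Ex; rewrite E0//=; apply: ub_le_sup => //; exists 1%R.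
    exact: Edown.
  rewrite -integral_itv_bndo_bndc; last first.
    apply: (measurable_funS mI) => // x /=; rewrite !in_itv/= => /andP[-> xs].
    by rewrite (le_trans (ltW xs)).
  congr (integral _ _ _); apply/seteqP; split => x /=; rewrite in_itv/=.
    move=> Ex; rewrite E0//= lt_neqAle; apply/andP; split.
      by apply/eqP => xs; apply: sE; rewrite -xs.
    by apply: ub_le_sup => //; exists 1%R.
  move=> /andP[x0 xs]; have [y Ey xy] := sup_gt (ex_intro _ e Ee) xs.
  by apply: (Edown y) => //; rewrite x0 ltW.
by rewrite !Es//; exact: gh.
Qed.

End rearrangement.

(** * Upper bound of the variation *)

Section inverse_integral.
Context {R : realType}.
Local Notation mu := (@lebesgue_measure R).

(** The inverse is nonincreasing on each open half-line; the point 0 is treated apart. *)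
Lemma measurable_invr : measurable_fun [set: R] (fun x : R => x^-1).
Proof.
have -> : [set: R] = `]-oo, 0[ `|` ([set 0] `|` `]0, +oo[).
  apply/seteqP; split => // x _ /=; rewrite !in_itv/= andbT.
  by have [x0|x0|->] := ltgtP x 0; [left|right; right|right; left].
apply/measurable_funU => //; first exact: measurableU.
split; last (apply/measurable_funU => //; split; first exact: measurable_fun_set1).
- apply/measurable_EFinP; apply: nonincreasing_emeasurable.
    exact: interval_is_interval.
  move=> x y /=; rewrite !in_itv/= => x0 y0 xy.
  by rewrite lee_fin lef_nV2 ?negrE.
- apply/measurable_EFinP; apply: nonincreasing_emeasurable.
    exact: interval_is_interval.
  move=> x y /=; rewrite !in_itv/= !andbT => x0 y0 xy.
  by rewrite lee_fin lef_pV2 ?posrE.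
Qed.

Lemma integral_invrD (a b z : R) : 0 < a + z -> a <= b ->
  (\int[mu]_(t in `[a, b]) ((t + z)^-1)%:E = (ln (b + z) - ln (a + z))%:E)%E.
Proof.
move=> az0; rewrite le_eqVlt => /predU1P[<-|ab].
  by rewrite subrr set_itv1 integral_set1.
have pos t : a <= t -> 0 < t + z by move=> ?; rewrite (lt_le_trans az0)// lerD2r.
have dF t : 0 < t + z -> is_derive t 1 (fun x => ln (x + z)) (t + z)^-1.
  move=> tz; have := is_derive1_ln tz => H.
  apply: is_derive_eq.
  by rewrite addr0 /GRing.scale/= mulr1.
have cF t : a <= t -> {for t, continuous (fun x => ln (x + z))}.
  move=> /pos /dF H; apply: differentiable_continuous.
  by apply/derivable1_diffP; exact: ex_derive.
rewrite (@continuous_FTC2 _ _ (fun x => ln (x + z)))//.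
- apply: continuous_in_subspaceT => t; rewrite inE/= in_itv/= => /andP[at_ _].
  apply: (@cvgV R R); first by rewrite gt_eqF// pos.
  by apply: cvgD; [exact: cvg_id|exact: cvg_cst].
- split.
  + move=> t; rewrite in_itv/= => /andP[/ltW/pos/dF H _]; exact: ex_derive.
  + by apply: cvg_at_right_filter; exact: cF.
  + by apply: cvg_at_left_filter; apply: cF; exact: ltW.
- move=> t; rewrite in_itv/= => /andP[/ltW/pos/dF H _].
  by rewrite derive1E; exact: derive_val.
Qed.

End inverse_integral.

Section fubini_tonelli_in.
Local Open Scope ereal_scope.
Context d1 d2 (T1 : measurableType d1) (T2 : measurableType d2) (R : realType).
Variables (m1 : {sigma_finite_measure set T1 -> \bar R}).
Variables (m2 : {sigma_finite_measure set T2 -> \bar R}).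
Variables (A : set T1) (B : set T2) (f : T1 * T2 -> \bar R).
Hypotheses (mA : measurable A) (mB : measurable B).
Hypotheses (mf : measurable_fun setT f) (f0 : forall p, 0 <= f p).

Let g := f \_ (A `*` B).

Let mg : measurable_fun setT g.
Proof.
apply: (measurable_restrictT f (measurableX mA mB)).1.
exact: measurable_funTS.
Qed.

Let g0 p : 0 <= g p.
Proof. by rewrite /g patchE; case: ifPn. Qed.

Let gE x y : g (x, y) =
  if x \in A then ((fun y => f (x, y)) \_ B) y else 0.
Proof. by rewrite /g !patchE in_setX/=; case: (x \in A). Qed.

Let gE' x y : g (x, y) =
  if y \in B then ((fun x => f (x, y)) \_ A) x else 0.
Proof. by rewrite /g !patchE in_setX/=; case: (x \in A); case: (y \in B). Qed.

Let int2E : (fun x => \int[m2]_y g (x, y)) =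
  (fun x => \int[m2]_(y in B) f (x, y)) \_ A.
Proof.
apply/funext => x; rewrite patchE; case: ifPn => xA.
  rewrite [RHS]integral_mkcond; apply: eq_integral => y _.
  by rewrite gE xA.
by apply: integral0_eq => y _; rewrite gE (negbTE xA).
Qed.

Let int1E : (fun y => \int[m1]_x g (x, y)) =
  (fun y => \int[m1]_(x in A) f (x, y)) \_ B.
Proof.
apply/funext => y; rewrite patchE; case: ifPn => yB.
  rewrite [RHS]integral_mkcond; apply: eq_integral => x _.
  by rewrite gE' yB.
by apply: integral0_eq => x _; rewrite gE' (negbTE yB).
Qed.

(** Tonelli for [g], the extension of [f] by zero off [A * B]; its partial integrals are those of
    [f], extended by zero. *)
Lemma fubini_tonelli_in :
  \int[m1]_(x in A) \int[m2]_(y in B) f (x, y) =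
  \int[m2]_(y in B) \int[m1]_(x in A) f (x, y).
Proof.
rewrite [LHS]integral_mkcond -int2E [RHS]integral_mkcond -int1E.
exact: fubini_tonelli.
Qed.

Lemma measurable_integral_snd :
  measurable_fun A (fun x => \int[m2]_(y in B) f (x, y)).
Proof.
apply/(measurable_restrictT _ mA); rewrite -int2E.
exact: measurable_fun_fubini_tonelli_F.
Qed.

Lemma measurable_integral_fst :
  measurable_fun B (fun y => \int[m1]_(x in A) f (x, y)).
Proof.
apply/(measurable_restrictT _ mB); rewrite -int1E.
exact: measurable_fun_fubini_tonelli_G.
Qed.

End fubini_tonelli_in.

(** * The vector measure as an integral of the kernels *)

Section cesaro.
Context {R : realType}.
Implicit Types (A : set R) (x y s t : R).
Local Notation mu := (@lebesgue_measure R).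
Local Notation cmu := (@completed_lebesgue_measure R).

Lemma cesaro_vmeasureE A x : lebesgue_measurable A ->
  cesaro_vmeasure A x = x^-1 * fine (mu (A `&` `[0, x])).
Proof.
move=> mA; rewrite /cesaro_vmeasure /cesaro; congr (_ * fine _).
by apply: (integral_indic cmu _ mA); exact: measurable_lebesgue.
Qed.

Lemma cesaro_vmeasure_ge0 A x : lebesgue_measurable A -> 0 <= x ->
  0 <= cesaro_vmeasure A x.
Proof.
by move=> mA x0; rewrite cesaro_vmeasureE// mulr_ge0 ?invr_ge0// fine_ge0.
Qed.

Lemma fin_num_lebesgue_measure01 A x : A `<=` `[0, 1] ->
  mu (A `&` `[0, x]) \is a fin_num.
Proof.
move=> A01; rewrite ge0_fin_numE ?measure_ge0//.
apply: (@le_lt_trans _ _ (mu `[0, 1])).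
  by apply: le_lebesgue_measure => t [/A01].
by rewrite lebesgue_measure_itv/= lte01 oppr0 adde0 ltry.
Qed.

(** Borel measurability holds although [A] is only Lebesgue measurable: the measure of the part of
    [A] in [[0, x]] is nondecreasing in [x]. *)
Lemma measurable_cesaro_vmeasure A (D : set R) : lebesgue_measurable A ->
  A `<=` `[0, 1] -> measurable_fun D (cesaro_vmeasure A).
Proof.
move=> mA A01; apply: measurable_funTS.
rewrite (_ : cesaro_vmeasure A = (fun x => x^-1 * fine (mu (A `&` `[0, x])))).
  apply: measurable_funM; first exact: measurable_invr.
  apply: nondecreasing_measurable => // x y xy.
  apply: fine_le; rewrite ?fin_num_lebesgue_measure01//.
  apply: le_lebesgue_measure => t [At /=]; rewrite !in_itv/= => /andP[t0 tx].
  by split => //; rewrite t0 (le_trans tx).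
by apply/funext => x; exact: cesaro_vmeasureE.
Qed.

Lemma FkerE y x : Fker y x = if y <= x <= 1 then x^-1 else 0.
Proof.
rewrite /Fker indicE; case: ifPn => yx.
  by rewrite mem_set ?mulr1//= in_itv.
by rewrite memNset ?mulr0//= in_itv/=; exact/negP.
Qed.

Lemma Fker_ge0 y x : 0 <= y -> 0 <= Fker y x.
Proof.
move=> y0; rewrite FkerE; case: ifPn => // /andP[yx _].
by rewrite invr_ge0 (le_trans y0).
Qed.

Lemma measurable_Fker2 :
  measurable_fun [set: R * R] (fun p : R * R => Fker p.2 p.1).
Proof.
rewrite (_ : (fun p : R * R => _) =
    (fun p => if p.2 <= p.1 <= 1 then p.1^-1 else 0)).
  apply: measurable_fun_ifT => //.
  - apply: measurable_and.
      by apply: measurable_fun_ler; [exact: measurable_snd|exact: measurable_fst].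
    by apply: measurable_fun_ler => //; exact: measurable_fst.
  - by apply: measurableT_comp; [exact: measurable_invr|exact: measurable_fst].
by apply/funext => p; rewrite FkerE.
Qed.

(** In the later use of Tonelli [y] ranges over a Lebesgue measurable set, so the second factor must
    carry the larger sigma-algebra. *)
Lemma measurable_lebesgue_pair d (T : measurableType d) (f : R * R -> T) :
  measurable_fun setT f ->
  measurable_fun setT (fun p : measurableTypeR R * lebesgueR => f (p.1, p.2 : R)).
Proof.
move=> mf.
have mp : measurable_fun setT
    (fun p : measurableTypeR R * lebesgueR => (p.1, p.2 : measurableTypeR R)).
  apply: measurable_fun_pair; first exact: measurable_fst.
  exact: (measurableT_comp measurable_id_lebesgue measurable_snd).
exact: measurableT_comp mp.
Qed.

(** For fixed [x], the function [y |-> Fker y x] is [x^-1] times the indicator of [[0, x]] on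
    [[0, 1]]. *)
Lemma cesaro_vmeasure_Fker A x : lebesgue_measurable A -> A `<=` `[0, 1] ->
  0 <= x <= 1 ->
  (cesaro_vmeasure A x)%:E = (\int[cmu]_(y in (A : set lebesgueR)) (Fker y x)%:E)%E.
Proof.
move=> mA A01 /andP[x0 x1].
rewrite cesaro_vmeasureE// EFinM fineK ?fin_num_lebesgue_measure01//.
have mI : measurable ((A `&` `[0, x]) : set lebesgueR).
  by apply: measurableI => //; exact: measurable_lebesgue.
transitivity (\int[cmu]_(y in (A `&` `[0%R, x] : set lebesgueR)) cst (x^-1)%:E y)%E.
  by rewrite (integral_cst cmu mI).
rewrite integral_mkcondr; apply: eq_integral => y /set_mem /A01.
rewrite /= in_itv/= => /andP[y0 y1]; rewrite patchE FkerE x1 andbT.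
have [yx|yx] := boolP (y <= x).
  by rewrite mem_set//= in_itv/= y0.
by rewrite memNset//= in_itv/= y0; exact/negP.
Qed.

(* The rearrangement of [Fker y] at [s], up to its value at the jump
   [s = 1 - y]. *)
Definition Fker_star s y : R := if y + s <= 1 then (y + s)^-1 else 0.

Definition Fker_excess s y x : R := Num.max (Fker y x - Fker_star s y) 0.

(* The bound of [integral_rearrangement_le] for [Fker y] at the level
   [Fker_star s y], for which it is an equality ([Fker_KE]). *)
Definition Fker_K s y : \bar R :=
  ((s * Fker_star s y)%:E + \int[mu]_(x in `[0%R, 1%R]) (Fker_excess s y x)%:E)%E.

Lemma Fker_star_ge0 s y : 0 <= s -> 0 <= y -> 0 <= Fker_star s y.
Proof. by move=> s0 y0; rewrite /Fker_star; case: ifPn => // _; rewrite invr_ge0 addr_ge0. Qed.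

Lemma measurable_Fker_star s : measurable_fun setT (Fker_star s).
Proof.
apply: measurable_fun_ifT => //.
- by apply: measurable_fun_ler => //; apply: measurable_funD.
- by apply: (measurableT_comp measurable_invr); apply: measurable_funD.
Qed.

Lemma measurable_Fker_excess s :
  measurable_fun [set: R * R] (fun p : R * R => (Fker_excess s p.2 p.1)%:E).
Proof.
apply/measurable_EFinP; apply: measurable_maxr => //.
apply: measurable_funB; first exact: measurable_Fker2.
by apply: (measurableT_comp (measurable_Fker_star s)); exact: measurable_snd.
Qed.

Lemma measurable_Fker_K s : measurable_fun (`[0, 1]%classic : set R) (Fker_K s).
Proof.
apply: emeasurable_funD.
  apply/measurable_EFinP; apply: measurable_funM => //.
  by apply: measurable_funTS; exact: measurable_Fker_star.
have := @measurable_integral_fst _ _ (measurableTypeR R) (measurableTypeR R) R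
  mu `[0, 1] `[0, 1] (fun p => (Fker_excess s p.2 p.1)%:E).
apply => //; first exact: measurable_Fker_excess.
by move=> p; rewrite lee_fin le_max lexx orbT.
Qed.

Lemma Fker_K_ge0 s y : 0 <= s -> 0 <= y -> (0 <= Fker_K s y)%E.
Proof.
move=> s0 y0; apply: adde_ge0; first by rewrite lee_fin mulr_ge0// Fker_star_ge0.
by apply: integral_ge0 => x _; rewrite lee_fin le_max lexx orbT.
Qed.

(* [cesaro_vmeasure A] is the integral over [A] of the functions [Fker y]; it is
   split at the integral over [A] of their levels [Fker_star s y]. *)
Lemma rearrangement_cesaro_le A s : lebesgue_measurable A -> A `<=` `[0, 1] ->
  0 < s <= 1 ->
  (\int[mu]_(t in `]0%R, s]) rearrangement (cesaro_vmeasure A) t <=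
   \int[cmu]_(y in (A : set lebesgueR)) Fker_K s y)%E.
Proof.
move=> mA A01 /andP[s0 s1]; have s0' := ltW s0.
have cmA : cmu A \is a fin_num.
  have := fin_num_lebesgue_measure01 1 A01.
  by rewrite (setIidl A01).
have Ay y : A y -> 0 <= y by move=> /A01 /=; rewrite in_itv/= => /andP[].
have mc (D : set R) : lebesgue_measurable D ->
   measurable_fun (D : set lebesgueR) (fun y : lebesgueR => (Fker_star s y)%:E).
  move=> mD; apply: (measurable_funS measurableT (@subsetT _ _)).
  apply: (measurable_fun_lebesgue measurableT); apply/measurable_EFinP.
  exact: measurable_Fker_star.
have c0 y : A y -> (0 <= (Fker_star s y)%:E)%E by move=> /Ay y0; rewrite lee_fin; exact: Fker_star_ge0.
pose tau := (\int[cmu]_(y in (A : set lebesgueR)) (Fker_star s y)%:E)%E.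
have tau0 : (0 <= tau)%E by apply: integral_ge0.
have taufin : tau \is a fin_num.
  rewrite ge0_fin_numE//.
  apply: (@le_lt_trans _ _ (\int[cmu]_(y in (A : set lebesgueR)) cst (s^-1)%:E y)%E).
    apply: (@ge0_le_integral _ lebesgueR R cmu A mA _ _ c0 (mc A mA) (measurable_cst _)).
    - move=> y /Ay y0; rewrite lee_fin /Fker_star; case: ifPn => _; last by rewrite invr_ge0 ltW.
      by rewrite lef_pV2 ?posrE ?lerDr// ltr_wpDl.
  by rewrite (integral_cst cmu mA) -ge0_fin_numE ?fin_numM// mule_ge0// lee_fin invr_ge0.
have mexc := measurable_lebesgue_pair (measurable_Fker_excess s).
have e0 y x : (0 <= (Fker_excess s y x)%:E)%E by rewrite lee_fin le_max lexx orbT.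
have m01 : measurable (`[0, 1]%classic : set R) by exact: measurable_itv.
have T1 := @fubini_tonelli_in _ _ (measurableTypeR R) lebesgueR R mu cmu
  `[0, 1] A _ m01 mA mexc (fun p => e0 p.2 p.1).
have T2 := @measurable_integral_snd _ _ (measurableTypeR R) lebesgueR R cmu
  `[0, 1] A _ m01 mA mexc (fun p => e0 p.2 p.1).
have T3 := @measurable_integral_fst _ _ (measurableTypeR R) lebesgueR R mu
  `[0, 1] A _ m01 mA mexc (fun p => e0 p.2 p.1).
apply: le_trans (@integral_rearrangement_le _ _ s (fine tau) _ _ _) _.
- exact: measurable_cesaro_vmeasure.
- by rewrite (ltW s0) s1.
- exact: fine_ge0.
have msc : measurable_fun (A : set lebesgueR) (fun y : lebesgueR => (s * Fker_star s y)%:E).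
  have /measurable_EFinP mcA := mc A mA.
  by apply/measurable_EFinP; exact: (measurable_funM (measurable_cst s) mcA).
have sc0 y : A y -> (0 <= (s * Fker_star s y)%:E)%E.
  by move=> /Ay y0; rewrite lee_fin mulr_ge0//; exact: Fker_star_ge0.
have I1 y : A y -> (0 <= \int[mu]_(x in `[0%R, 1%R]) (Fker_excess s y x)%:E)%E.
  by move=> _; apply: integral_ge0 => x _; exact: e0.
have -> : (\int[cmu]_(y in (A : set lebesgueR)) Fker_K s y =
    (s * fine tau)%:E + \int[cmu]_(y in (A : set lebesgueR))
      \int[mu]_(x in `[0%R, 1%R]) (Fker_excess s y x)%:E)%E.
  rewrite EFinM fineK// /tau.
  rewrite -(@ge0_integralZl _ lebesgueR R cmu A mA _ (mc A mA) s%:E c0); last first.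
    by rewrite lee_fin.
  exact: (@ge0_integralD _ lebesgueR R cmu A mA _ _ sc0 msc I1 T3).
apply: leeD; first exact: lexx.
rewrite -T1; apply: ge0_le_integral => //=.
- by move=> x _; rewrite lee_fin le_max lexx orbT.
- apply/measurable_EFinP; apply: measurable_maxr => //.
  apply: measurable_funB => //; apply: measurableT_comp => //.
  exact: measurable_cesaro_vmeasure.
move=> x; rewrite in_itv/= => x01; have /andP[x0 x1] := x01.
rewrite ger0_norm ?cesaro_vmeasure_ge0//.
have I0 : (0 <= \int[cmu]_(y in (A : set lebesgueR)) (Fker_excess s y x)%:E)%E.
  by apply: integral_ge0 => y _; exact: e0.
have mex : measurable_fun (A : set lebesgueR) (fun y : lebesgueR => (Fker_excess s y x)%:E).
  have := measurable_fun_pair2 x mexc.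
  exact: measurable_funS.
(* Integrating [Fker y x <= Fker_star s y + Fker_excess s y x] over [A] bounds the excess of
   [cesaro_vmeasure A x] over [tau]. *)
rewrite EFin_max ge_max I0 andbT EFinB fineK// leeBlDl//.
rewrite cesaro_vmeasure_Fker//.
have F0 y : A y -> (0 <= (Fker y x)%:E)%E.
  by move=> /Ay y0; rewrite lee_fin Fker_ge0.
have mF : measurable_fun (A : set lebesgueR) (fun y : lebesgueR => (Fker y x)%:E).
  have := measurable_fun_pair2 x (measurable_lebesgue_pair measurable_Fker2).
  move=> /measurable_EFinP; exact: measurable_funS.
have e0' y (_ : A y) := e0 y x.
rewrite -(@ge0_integralD _ lebesgueR R cmu A mA _ _ c0 (mc A mA) e0' mex).
apply: (@ge0_le_integral _ lebesgueR R cmu A mA _ _ F0 mF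
  (@emeasurable_funD _ lebesgueR R A _ _ (mc A mA) mex)).
by move=> y _; rewrite -EFinD lee_fin -lerBlDl /Fker_excess le_max lexx.
Qed.

End cesaro.

Section variation_le.
Context {R : realType}.
Implicit Types (A : set R) (x y s t : R).
Local Notation mu := (@lebesgue_measure R).
Local Notation cmu := (@completed_lebesgue_measure R).

Let measurable_EFin_invrD (D : set R) z :
  measurable_fun D (fun x : R => ((x + z)^-1)%:E).
Proof.
apply: measurable_funTS; apply/measurable_EFinP.
by apply: (measurableT_comp measurable_invr); exact: measurable_funD.
Qed.

(** On []0, s]] the integrand is [(t + y)^-1] up to [b - y], where [b] is the minimum of [y + s] and
    1, and zero beyond. *)
Lemma integral_Fker_star_fst s y : 0 < s -> 0 < y <= 1 ->
  (\int[mu]_(t in `]0%R, s]) (Fker_star t y)%:E =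
   (ln (Num.min (y + s) 1) - ln y)%:E)%E.
Proof.
move=> s0 /andP[y0 y1]; set b := Num.min _ _.
have yb : y <= b by rewrite le_min y1 andbT lerDl ltW.
transitivity (\int[mu]_(t in `]0%R, (b - y)%R]) ((t + y)^-1)%:E)%E.
  rewrite [LHS]integral_mkcond [RHS]integral_mkcond; apply: eq_integral => t _.
  have bE : (t <= b - y) = (t <= s) && (y + t <= 1).
    by rewrite lerBrDr addrC le_min lerD2l.
  rewrite !patchE; have [tb|tb] := boolP (0 < t <= b - y).
    move: (tb); rewrite bE => /and3P[t0 ts ty].
    rewrite !mem_set/= ?in_itv/= ?tb ?t0//.
    by rewrite /Fker_star ty addrC.
  rewrite [RHS]ifF; last by apply/negP; rewrite inE/= in_itv/=; exact/negP.
  case: ifPn => //; rewrite inE/= in_itv/= => /andP[t0 ts].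
  by rewrite /Fker_star ifF//; apply/negbTE; move: tb; rewrite bE t0 ts.
rewrite integral_itv_obnd_cbnd; last exact: measurable_EFin_invrD.
by rewrite integral_invrD ?subr_ge0 ?add0r// subrK.
Qed.

(** The excess is [x^-1 - c] on [[y, b]] and zero elsewhere, while [s * c] is the integral of [c]
    over [[y, b]]; both sides are thus the integral of [x^-1] over [[y, b]]. *)
Lemma Fker_KE s y : 0 < s -> 0 < y <= 1 ->
  Fker_K s y = (\int[mu]_(t in `]0%R, s]) (Fker_star t y)%:E)%E.
Proof.
move=> s0 y01; rewrite integral_Fker_star_fst//.
have /andP[y0 y1] := y01; set b := Num.min _ _; set c := Fker_star s y.
have yb : y <= b by rewrite le_min y1 andbT lerDl ltW.
have c0 : 0 <= c by apply: Fker_star_ge0; exact: ltW.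
have cb x : y <= x -> x <= 1 -> (x <= b) = (c <= x^-1).
  move=> yx x1; have x0 := lt_le_trans y0 yx; rewrite le_min x1 andbT.
  rewrite /c /Fker_star; case: ifPn => [ys1|].
    by rewrite lef_pV2 ?posrE// addr_gt0.
  by rewrite -ltNge => /ltW ys1; rewrite (le_trans x1 ys1) invr_ge0 ltW.
have mI : measurable (`[y, b]%classic : set R) by exact: measurable_itv.
have pos x : `[y, b]%classic x -> (0 <= (x^-1 - c)%:E)%E.
  rewrite /= in_itv/= lee_fin subr_ge0 => /andP[yx xb].
  by rewrite -cb// (le_trans xb)// ge_min lexx orbT.
have mexc : measurable_fun (`[y, b]%classic : set R) (fun x => (x^-1 - c)%:E).
  apply: measurable_funTS; apply/measurable_EFinP.
  by apply: measurable_funB => //; exact: measurable_invr.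
rewrite /Fker_K.
have -> : (\int[mu]_(x in `[0%R, 1%R]) (Fker_excess s y x)%:E =
    \int[mu]_(x in `[y, b]) (x^-1 - c)%:E)%E.
  rewrite [LHS]integral_mkcond [RHS]integral_mkcond; apply: eq_integral => x _.
  rewrite !patchE; have [xyb|xyb] := boolP (y <= x <= b).
    have /andP[yx xb] := xyb; have x1 : x <= 1 by rewrite (le_trans xb)// ge_min lexx orbT.
    rewrite !mem_set/= ?in_itv/= ?xyb ?x1 ?(le_trans (ltW y0))//.
    rewrite /Fker_excess FkerE yx x1/= (max_idPl _)// subr_ge0 -/c.
    by rewrite -cb.
  rewrite [RHS]ifF; last by apply/negP; rewrite inE/= in_itv/=; exact/negP.
  case: ifPn => //; rewrite inE/= in_itv/= => /andP[x0 x1].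
  rewrite /Fker_excess FkerE x1 andbT -/c; case: ifPn => yx.
    rewrite (max_idPr _)// subr_le0 ltW// ltNge -cb//.
    by move: xyb; rewrite yx.
  by rewrite sub0r (max_idPr _)// oppr_le0.
(* Either [y + s <= 1] and [b - y = s], or [c = 0]. *)
have -> : s * c = c * (b - y).
  rewrite /c /Fker_star /b; case: ifPn => [/min_idPl ->|_]; last by rewrite mulr0 mul0r.
  by rewrite addrAC subrr add0r mulrC.
rewrite EFinM.
have -> : ((b - y)%:E = mu `[y, b])%E.
  rewrite lebesgue_measure_itv/= lte_fin -EFinB.
  by move: yb; rewrite le_eqVlt => /predU1P[->|->//]; rewrite ltxx subrr.
have mcst : measurable_fun (`[y, b]%classic : set R) (cst c%:E) by exact: measurable_cst.
have cst0 x : `[y, b]%classic x -> (0 <= cst c%:E x :> \bar R)%E by rewrite lee_fin.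
rewrite -(integral_cst mu mI) -(ge0_integralD mu mI cst0 mcst pos mexc).
transitivity (\int[mu]_(x in `[y, b]) ((x + 0)^-1)%:E)%E.
  by apply: eq_integral => x _; rewrite /= -EFinD addrCA subrr !addr0.
by rewrite integral_invrD ?addr0.
Qed.

Lemma integral_Fker_star_snd t : 0 < t <= 1 ->
  (\int[mu]_(y in `[0%R, 1%R]) (Fker_star t y)%:E = (ln (1 / t))%:E)%E.
Proof.
move=> /andP[t0 t1].
transitivity (\int[mu]_(y in `[0%R, (1 - t)%R]) ((y + t)^-1)%:E)%E.
  rewrite [LHS]integral_mkcond [RHS]integral_mkcond; apply: eq_integral => y _.
  rewrite !patchE; have [yt|yt] := boolP (0 <= y <= 1 - t).
    have /andP[y0 y1] := yt; rewrite !mem_set/= ?in_itv/= ?yt ?y0//.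
      by rewrite /Fker_star -lerBrDr y1.
    by rewrite (le_trans y1)// lerBlDr lerDl ltW.
  rewrite [RHS]ifF; last by apply/negP; rewrite inE/= in_itv/=; exact/negP.
  case: ifPn => //; rewrite inE/= in_itv/= => /andP[y0 y1].
  by rewrite /Fker_star ifF// -lerBrDr; apply/negbTE; move: yt; rewrite y0.
rewrite integral_invrD ?add0r ?subr_ge0//.
by rewrite subrK ln1 sub0r div1r lnV ?posrE.
Qed.

Lemma measurable_Fker_star2 :
  measurable_fun [set: R * R] (fun p : R * R => (Fker_star p.1 p.2)%:E).
Proof.
apply/measurable_EFinP; apply: measurable_fun_ifT => //.
- by apply: measurable_fun_ler => //; apply: measurable_funD;
    [exact: measurable_snd|exact: measurable_fst].
- by apply: (measurableT_comp measurable_invr); apply: measurable_funD;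
    [exact: measurable_snd|exact: measurable_fst].
Qed.

Lemma integral_Fker_K s : 0 < s <= 1 ->
  (\int[mu]_(y in `[0%R, 1%R]) Fker_K s y =
   \int[mu]_(t in `]0%R, s]) (ln (1 / t))%:E)%E.
Proof.
move=> /andP[s0 s1].
have mI : measurable (`]0, s]%classic : set R) by exact: measurable_itv.
have mJ : measurable (`]0, 1]%classic : set R) by exact: measurable_itv.
(* The absolute values make the integrand nonnegative on the whole plane, as [fubini_tonelli_in]
   asks; they disappear on the domain of integration. *)
have mf : measurable_fun setT (fun p : measurableTypeR R * measurableTypeR R =>
    (Fker_star `|p.1| `|p.2|)%:E).
  have mn : measurable_fun setT (fun p : R * R => (`|p.1|, `|p.2|)).
    by apply: measurable_fun_pair; apply: measurableT_comp.
  exact: (measurableT_comp measurable_Fker_star2 mn).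
have f0 (p : R * R) : (0 <= (Fker_star `|p.1| `|p.2|)%:E)%E.
  by rewrite lee_fin Fker_star_ge0.
have TE := @fubini_tonelli_in _ _ (measurableTypeR R) (measurableTypeR R) R mu mu
  _ _ _ mI mJ mf f0.
rewrite -integral_itv_obnd_cbnd; last first.
  apply: (measurable_funS _ _ (measurable_Fker_K s)); first exact: measurable_itv.
  by move=> x /=; rewrite !in_itv/= => /andP[/ltW -> ->].
transitivity (\int[mu]_(y in `]0%R, 1%R])
    \int[mu]_(t in `]0%R, s]) (Fker_star `|t| `|y|)%:E)%E.
  apply: eq_integral => y /set_mem/=; rewrite in_itv/= => /[dup] y01 /andP[y0 _].
  rewrite Fker_KE//; apply: eq_integral => t /set_mem/=; rewrite in_itv/= => /andP[t0 _].
  by rewrite !gtr0_norm.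
rewrite -TE; apply: eq_integral => t /set_mem/=; rewrite in_itv/= => /andP[t0 ts].
have t1 := le_trans ts s1.
rewrite -integral_Fker_star_snd ?t0// -[RHS]integral_itv_obnd_cbnd; last first.
  apply: measurable_funTS; apply/measurable_EFinP; exact: measurable_Fker_star.
apply: eq_integral => y /set_mem/=; rewrite in_itv/= => /andP[y0 _].
by rewrite !gtr0_norm.
Qed.

(** By Hardy's lemma the weight can be replaced by the indicators of []0, s]]. There
    [rearrangement_cesaro_le] bounds each summand by the integral of one function [Fker_K s] over
    its part. *)
Lemma sum_lorentz_norm_cesaro_le (phi : lorentz_weight R) n (P : 'I_n -> set R) :
  (forall i, lebesgue_measurable (P i)) -> trivIset setT P ->
  \bigcup_i P i = `[0, 1]%classic ->
  (\sum_(i < n) lorentz_norm phi (cesaro_vmeasure (P i)) <=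
   \int[mu]_(t in `]0%R, 1%R]) ((weight_density phi t)%:E * (ln (1 / t))%:E))%E.
Proof.
move=> mP tP UP.
have P01 i : P i `<=` `[0, 1] by rewrite -UP => x Px; exists i.
pose r i t := rearrangement (cesaro_vmeasure (P i)) t.
have mr i (D : set R) : measurable D -> measurable_fun D (r i).
  exact: measurable_rearrangement.
have r0 i t : (0 <= r i t)%E by exact: rearrangement_ge0.
have mJ : measurable (`]0, 1]%classic : set R) by exact: measurable_itv.
have w0 t : (0 <= (weight_density phi t)%:E)%E by rewrite lee_fin weight_density_ge0.
have mw (D : set R) : measurable_fun D (fun t => (weight_density phi t)%:E).
  exact: emeasurable_weight_density.
have -> : (\sum_(i < n) lorentz_norm phi (cesaro_vmeasure (P i)) =
    \int[mu]_(t in `]0%R, 1%R]) ((weight_density phi t)%:E * \sum_(i < n) r i t))%E.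
  transitivity (\sum_(i < n) \int[mu]_(t in `]0%R, 1%R]) ((weight_density phi t)%:E * r i t))%E.
    apply: eq_bigr => i _; rewrite lorentz_normE integral_itv_obnd_cbnd//.
    by apply: emeasurable_funM; [exact: mw|exact: mr].
  rewrite -ge0_integral_sum//.
  - by apply: eq_integral => t _; rewrite ge0_sume_distrr.
  - by move=> i; apply: emeasurable_funM; [exact: mw|exact: mr].
  - by move=> i t _; exact: mule_ge0.
have mln : measurable_fun (`]0, 1]%classic : set R) (fun t : R => (ln (1 / t))%:E).
  apply: measurable_funTS; apply/measurable_EFinP; apply: (measurableT_comp (@measurable_ln R)).
  by apply: measurable_funM => //; exact: measurable_invr.
apply: weight_density_integral_le => //.
- by apply: emeasurable_sum => i; exact: mr.
- by move=> t _; apply: sume_ge0.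
- move=> t; rewrite in_itv/= => /andP[t0 t1].
  by rewrite lee_fin div1r ln_ge0// invf_ge1.
move=> s /andP[s0 s1]; move: s0; rewrite le_eqVlt => /predU1P[<-|s0].
  by rewrite set_itvoc0 !integral_set0.
have s01 : 0 < s <= 1 by rewrite s0.
have mI : measurable (`]0, s]%classic : set R) by exact: measurable_itv.
rewrite ge0_integral_sum//; last by move=> i; exact: mr.
apply: (@le_trans _ _ (\sum_(i < n)
    \int[cmu]_(y in (P i : set lebesgueR)) Fker_K s y)%E).
  by apply: lee_sum => i _; exact: rearrangement_cesaro_le.
have bigP : \big[setU/set0]_(i < n) P i = `[0, 1]%classic.
  rewrite -UP -bigcup_seq; apply: eq_bigcupl; split => // i _ /=.
  exact: mem_index_enum.
have mJ' : measurable (`[0, 1]%classic : set R) by exact: measurable_itv.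
have mK := measurable_fun_lebesgue mJ' (measurable_Fker_K s).
have K0 y : `[0, 1]%classic y -> (0 <= Fker_K s y)%E.
  by rewrite /= in_itv/= => /andP[y0 _]; apply: Fker_K_ge0 => //; exact: ltW.
have tPs : trivIset [set` index_enum 'I_n] (P : 'I_n -> set lebesgueR).
  by move=> i j _ _; exact: tP.
(* The bounds add up to the integral of [Fker_K s] over [[0, 1]], whatever the partition. *)
rewrite -(@ge0_integral_bigsetU _ lebesgueR R cmu _ P _ (index_enum 'I_n) mP
  (index_enum_uniq _) tPs); last 2 first.
- by rewrite bigP.
- by rewrite bigP.
rewrite bigP -integral_Fker_K//.
rewrite le_eqVlt; apply/orP; left; apply/eqP.
exact: (ge0_lebesgue_integralE mJ' (measurable_Fker_K s) K0).
Qed.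

End variation_le.

(** * Lower bound of the variation *)

Section variation_ge.
Context {R : realType}.
Implicit Types (A : set R) (f : R -> R) (x y s t c : R).
Local Notation mu := (@lebesgue_measure R).

(** For [tau < c / (s + y)] the superlevel set at [tau] contains [[y, b]] for some [b > s + y]: any
    [b <= 1] with [tau * b < c] will do. *)
Lemma rearrangement_ge_invr f c y s : 0 < y -> 0 <= s -> s < 1 - y -> 0 < c ->
  (forall x, y <= x <= 1 -> c / x <= `|f x|) ->
  ((c / (s + y))%:E <= rearrangement f s)%E.
Proof.
move=> y0 s0 sy c0 fc; apply: rearrangement_ge => tau tau0.
have sy0 : 0 < s + y by rewrite ltr_wpDl.
rewrite lte_fin ltr_pdivlMr// => tausy.
suff [b [syb b1 taub]] : exists b, [/\ s + y < b, b <= 1 & tau * b < c].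
  exists y, b; split.
  - by rewrite (le_trans _ (ltW syb))// lerDr.
  - by rewrite ltrBrDr.
  - move=> x /andP[yx xb]; have x0 := lt_le_trans y0 yx.
    have x1 := le_trans xb b1; split; first by rewrite (ltW x0).
    rewrite (lt_le_trans _ (fc x _)) ?yx// ltr_pdivlMr//.
    by rewrite (le_lt_trans _ taub)// ler_wpM2l.
have [tauc|tauc] := ltP tau c.
  by exists 1; rewrite mulr1 lexx; split => //; rewrite -ltrBrDr.
have tau0' := lt_le_trans c0 tauc.
(* When [tau >= c], take [b] halfway between [s + y] and [c / tau], which is at most 1. *)
exists ((s + y + c / tau) / 2); split.
- have : s + y < c / tau by rewrite ltr_pdivlMr// mulrC.
  by lra.
- have : c / tau <= 1 by rewrite ler_pdivrMr// mul1r.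
  by move: sy; lra.
- rewrite (_ : tau * _ = (tau * (s + y) + c) / 2); first by lra.
  by field; rewrite gt_eqF.
Qed.

(** [Fker y] exceeds [(s + y)^-1] only inside [[y, s + y]], and its support [[y, 1]] has length
    [1 - y]. At the jump [s = 1 - y] the value is 0, by right continuity, whereas [Fker_star] takes
    the left limit. *)
Lemma rearrangement_Fker y s : 0 < y <= 1 -> 0 <= s ->
  rearrangement (Fker y) s = (if s < 1 - y then (s + y)^-1 else 0)%:E.
Proof.
move=> /andP[y0 y1] s0; apply/eqP; rewrite eq_le; apply/andP; split.
  case: ifPn => [sy1|]; last rewrite -leNgt => sy1.
    apply: (@rearrangement_le _ _ y (s + y)); rewrite ?lerDr ?addrK//.
      by rewrite invr_ge0 addr_ge0// ltW.
    move=> x _; rewrite FkerE; case: ifPn => [/andP[yx x1]|_]; last first.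
      by rewrite normr0 ltNge invr_ge0 addr_ge0// ltW.
    have x0 := lt_le_trans y0 yx.
    have sy0 : 0 < s + y by rewrite ltr_wpDl.
    rewrite gtr0_norm ?invr_gt0// ltf_pV2 ?posrE// yx.
    by move=> /ltW.
  apply: (@rearrangement_le _ _ y 1) => // x _; rewrite FkerE.
  by case: ifPn => //; rewrite normr0 ltxx.
case: ifPn => [sy1|_]; last exact: rearrangement_ge0.
rewrite -[_^-1]mul1r; apply: rearrangement_ge_invr => // x yx1.
have /andP[yx _] := yx1; have x0 := lt_le_trans y0 yx.
by rewrite FkerE yx1 mul1r ger0_norm// invr_ge0 ltW.
Qed.

Lemma lorentz_norm_Fker (phi : lorentz_weight R) y : 0 < y <= 1 ->
  lorentz_norm phi (Fker y) =
  (\int[mu]_(t in `]0%R, (1 - y)%R[) ((weight_density phi t)%:E * ((t + y)^-1)%:E))%E.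
Proof.
move=> y01; have /andP[y0 y1] := y01.
rewrite lorentz_normE integral_itv_obnd_cbnd; last first.
  apply: emeasurable_funM; first exact: emeasurable_weight_density.
  by apply/measurable_EFinP; apply: (measurableT_comp measurable_invr);
    exact: measurable_funD.
rewrite [LHS]integral_mkcond [RHS]integral_mkcond; apply: eq_integral => t _.
rewrite !patchE; have [ty|ty] := boolP (0 <= t < 1 - y).
  have /andP[t0 t1] := ty; rewrite !mem_set/= ?in_itv/= ?ty ?t0//.
    by rewrite rearrangement_Fker// t1.
  by rewrite (le_trans (ltW t1))// lerBlDr lerDl ltW.
rewrite [RHS]ifF; last by apply/negP; rewrite inE/= in_itv/=; exact/negP.
case: ifPn => //; rewrite inE/= in_itv/= => /andP[t0 t1].
by rewrite rearrangement_Fker// ifF ?mule0//; apply/negbTE; move: ty; rewrite t0.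
Qed.

(** The function is nonnegative and decreasing on []0, 1]], hence its own rearrangement there. *)
Lemma rearrangement_ln s : 0 < s <= 1 ->
  rearrangement (fun t : R => ln (1 / t)) s = (ln (1 / s))%:E.
Proof.
move=> /andP[s0 s1].
have lnE t : 0 < t -> ln (1 / t) = - ln t by move=> t0; rewrite div1r lnV ?posrE.
apply/eqP; rewrite eq_le; apply/andP; split.
  apply: (@rearrangement_le _ _ 0 s); [|exact: ltW|by rewrite subr0|].
    by rewrite lnE// oppr_ge0 ln_le0.
  move=> x; rewrite in_itv/= => /andP[x0 x1] sx; rewrite x0/= leNgt.
  apply/negP => sx'; move: sx; apply/negP; rewrite -leNgt.
  have xp := lt_trans s0 sx'.
  rewrite !lnE// ger0_norm ?oppr_ge0 ?ln_le0// lerN2 ler_ln ?posrE//.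
  exact: ltW.
apply: rearrangement_ge => tau tau0; rewrite lte_fin lnE// => taus.
have : s < expR (- tau) by rewrite -(@lnK _ s) ?posrE// ltr_expR ltrNr.
have e1 : expR (- tau) <= 1 by rewrite -[leRHS]expR0 ler_expR oppr_le0.
set e := expR _ in e1 * => se.
(* A closed interval inside []0, e[], where the function exceeds [tau]; its length is
   [(e + s) / 2 > s]. *)
exists ((e - s) / 4), (e - (e - s) / 4); split; [lra|lra|].
move=> x /andP[x1 x2]; have x0 : 0 < x by lra.
have x3 : x <= 1 by lra.
split; first by rewrite x3 ltW.
rewrite lnE// ger0_norm ?oppr_ge0 ?ln_le0// ltrNr -[ltRHS]expRK.
by rewrite ltr_ln ?posrE ?expR_gt0// -/e; lra.
Qed.

Lemma measurable_ln_inv (D : set R) : measurable_fun D (fun t : R => ln (1 / t)).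
Proof.
apply: measurable_funTS; apply: (measurableT_comp (@measurable_ln R)).
by apply: measurable_funM => //; exact: measurable_invr.
Qed.

Lemma lorentz_norm_ln (phi : lorentz_weight R) :
  lorentz_norm phi (fun t => ln (1 / t)) =
  (\int[mu]_(t in `]0%R, 1%R]) ((weight_density phi t)%:E * (ln (1 / t))%:E))%E.
Proof.
rewrite lorentz_normE -integral_itv_obnd_cbnd; last first.
  apply: emeasurable_funM; first exact: emeasurable_weight_density.
  exact: measurable_rearrangement.
apply: eq_integral => t /set_mem/=; rewrite in_itv/= => t01.
by rewrite rearrangement_ln.
Qed.

(** * Uniform partitions into intervals of length [h] *)

Section uniform_partition.
Variable n : nat.
Let h : R := n.+1%:R^-1.

Let h0 : 0 < h. Proof. by rewrite invr_gt0. Qed.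

Let nh : n.+1%:R * h = 1.
Proof. by rewrite /h divff// pnatr_eq0. Qed.

Let ih0 (i : nat) : 0 <= i%:R * h.
Proof. by rewrite mulr_ge0// ltW. Qed.

(** The minimum with [n] puts the point 1 into the last part. *)
Let index x : nat := minn n (Num.truncn (x * n.+1%:R)).

Let P (i : 'I_n.+1) : set R := [set x | 0 <= x <= 1 /\ index x = i].

Let P01 i : P i `<=` `[0, 1].
Proof. by move=> x [x01 _]; rewrite /= in_itv. Qed.

Let index_le x y : x <= y -> (index x <= index y)%N.
Proof.
move=> xy; rewrite /index leq_min geq_minl/= geq_min; apply/orP; right.
by apply: le_truncn; rewrite ler_pM2r.
Qed.

Let measurable_P i : measurable (P i).
Proof.
apply: is_interval_measurable => x y [/andP[x0 x1] xi] [/andP[y0 y1] yi] z.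
move=> /andP[xz zy]; split; first by rewrite (le_trans x0)// (le_trans zy).
by apply/eqP; rewrite eqn_leq -{1}yi -xi !index_le.
Qed.

Let sub_P (i : 'I_n.+1) : `[i%:R * h, i.+1%:R * h[ `<=` P i.
Proof.
move=> x /=; rewrite in_itv/= => /andP[ix xi].
have xN : (i%:R : R) <= x * n.+1%:R < i.+1%:R.
  by rewrite -ler_pdivrMr// -ltr_pdivlMr// ix.
split.
  rewrite (le_trans (ih0 i) ix)/= (le_trans (ltW xi))// -[leRHS]nh.
  by rewrite ler_pM2r// ler_nat.
by rewrite /index (truncn_def xN); apply/minn_idPr; rewrite -ltnS.
Qed.

(** To the left of [x] the part [P i] contains an interval of length [h]. *)
Let lebesgue_P (i : 'I_n.+1) x : i.+1%:R * h <= x -> x <= 1 ->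
  h / x <= `|cesaro_vmeasure (P i) x|.
Proof.
move=> ix x1; have x0 : 0 < x by apply: lt_le_trans ix; rewrite mulr_gt0.
have mP : lebesgue_measurable (P i) by exact: measurable_lebesgue.
rewrite ger0_norm; last exact: cesaro_vmeasure_ge0 (ltW x0).
rewrite cesaro_vmeasureE//.
rewrite mulrC ler_pM2l ?invr_gt0// -lee_fin fineK ?fin_num_lebesgue_measure01//.
rewrite (_ : h%:E = mu `[i%:R * h, i.+1%:R * h[).
  apply: le_lebesgue_measure => y iy; split; first exact: sub_P.
  move: iy; rewrite /= !in_itv/= => /andP[iy yi].
  by rewrite (le_trans (ih0 i) iy) (le_trans (ltW yi)).
rewrite lebesgue_measure_itv/= lte_fin ltr_pM2r// ltr_nat ltnSn -EFinB.
by rewrite -mulrBl -natr1 addrAC subrr add0r mul1r.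
Qed.

Let L u : R := ln (Num.min u 1).

Let L1 u : 1 <= u -> L u = 0.
Proof. by move=> u1; rewrite /L (min_idPr u1) ln1. Qed.

(** For [u < 1] this is [ln (1 + h / u) <= h / u]; beyond 1 the truncated logarithm is constant. *)
Let L_increment u : 0 < u ->
  L (u + h) - L u <= if u < 1 then h / u else 0.
Proof.
move=> u0; case: ifPn => [u1|]; last first.
  rewrite -leNgt => u1; rewrite !L1 ?subrr//.
  by rewrite (le_trans u1)// lerDl ltW.
have uh0 : 0 < u + h by rewrite addr_gt0.
rewrite /L (min_idPl (ltW u1)).
apply: (@le_trans _ _ (ln (u + h) - ln u)).
  rewrite lerD2r ler_ln ?posrE ?lt_min ?uh0 ?ltr01//.
  by rewrite ge_min lexx.
rewrite -ln_div ?posrE// mulrDl divff ?gt_eqF//.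
by apply: le_ln1Dx; rewrite (lt_trans (ltrN10 _))// divr_gt0.
Qed.

(** The rearrangement of [cesaro_vmeasure (P i)] at [t] is at least [g i t], and the sum of the
    [g i t] dominates a telescoping sum of increments of [L]. *)
Lemma lorentz_variation_ge (phi : lorentz_weight R) :
  (\int[mu]_(t in `]0%R, 1%R])
     ((weight_density phi t)%:E * (- ln (Num.min (t + n.+1%:R^-1) 1))%:E) <=
   lorentz_variation phi `[0%R, 1%R])%E.
Proof.
have mP i : lebesgue_measurable (P i) by exact: measurable_lebesgue.
apply: (@le_trans _ _ (\sum_(i < n.+1) lorentz_norm phi (cesaro_vmeasure (P i)))%E).
  pose g (i : 'I_n.+1) t : R :=
    if t + i.+1%:R * h < 1 then h / (t + i.+1%:R * h) else 0.
  have m01 : measurable (`]0, 1]%classic : set R) by exact: measurable_itv.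
  have mw (D : set R) : measurable_fun D (fun t => (weight_density phi t)%:E).
    exact: emeasurable_weight_density.
  have w0 t : (0 <= (weight_density phi t)%:E)%E.
    by rewrite lee_fin weight_density_ge0.
  have mg i (D : set R) : measurable_fun D (fun t => (g i t)%:E).
    apply: measurable_funTS; apply/measurable_EFinP; apply: measurable_fun_ifT => //.
      by apply: measurable_fun_ltr => //; exact: measurable_funD.
    apply: measurable_funM => //; apply: (measurableT_comp measurable_invr).
    exact: measurable_funD.
  have pos i t : 0 < t -> 0 < t + i.+1%:R * h by move=> t0; rewrite addr_gt0// mulr_gt0.
  have g0 i t : 0 < t -> (0 <= (g i t)%:E)%E.
    move=> t0; rewrite lee_fin /g; case: ifPn => // _.
    by rewrite divr_ge0 ?(ltW h0)// ltW// pos.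
  apply: (@le_trans _ _ (\sum_(i < n.+1)
      \int[mu]_(t in `]0%R, 1%R]) ((weight_density phi t)%:E * (g i t)%:E))%E); last first.
    apply: lee_sum => i _; rewrite lorentz_normE -integral_itv_obnd_cbnd; last first.
      by apply: emeasurable_funM; [exact: mw|exact: measurable_rearrangement].
    apply: ge0_le_integral => //.
    - by move=> t /=; rewrite in_itv/= => /andP[t0 _]; apply: mule_ge0 => //; exact: g0.
    - by apply: emeasurable_funM; [exact: mw|exact: mg].
    - by apply: emeasurable_funM; [exact: mw|exact: measurable_rearrangement].
    - move=> t /=; rewrite in_itv/= => /andP[t0 t1]; apply: lee_wpmul2l => //.
      rewrite /g; case: ifPn => [ti|_]; last exact: rearrangement_ge0.
      apply: rearrangement_ge_invr; rewrite ?(ltW t0) ?ltrBrDr ?mulr_gt0//.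
      by move=> x /andP[ix x1]; exact: lebesgue_P.
  rewrite -ge0_integral_sum//; last 2 first.
  - by move=> i; apply: emeasurable_funM; [exact: mw|exact: mg].
  - by move=> i t /=; rewrite in_itv/= => /andP[t0 _]; apply: mule_ge0 => //; exact: g0.
  apply: ge0_le_integral => //.
  - move=> t /=; rewrite in_itv/= => /andP[t0 _]; apply: mule_ge0 => //.
    by rewrite lee_fin oppr_ge0 ln_le0// ge_min lexx orbT.
  - apply: emeasurable_funM; first exact: mw.
    apply/measurable_EFinP; apply: measurable_funTS; apply: measurableT_comp => //.
    apply: (measurableT_comp (@measurable_ln R)).
    by apply: measurable_minr => //; exact: measurable_funD.
  - by apply: emeasurable_sum => i; apply: emeasurable_funM; [exact: mw|exact: mg].
  - move=> t /=; rewrite in_itv/= => /andP[t0 t1].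
    rewrite -ge0_sume_distrr; last by move=> i _; exact: g0.
    apply: lee_wpmul2l => //; rewrite sumEFin lee_fin.
    apply: (@le_trans _ _ (\sum_(i < n.+1)
        (L (t + i.+1%:R * h + h) - L (t + i.+1%:R * h)))); last first.
      by apply: ler_sum => i _; rewrite L_increment// pos.
    rewrite (eq_bigr (fun i : 'I_n.+1 =>
      L (t + i.+2%:R * h) - L (t + i.+1%:R * h))); last first.
      move=> i _; congr (L _ - _); rewrite -addrA; congr (_ + _).
      by rewrite -[i.+2%:R]natr1 mulrDl mul1r.
    rewrite -(big_mkord xpredT (fun i => L (t + i.+2%:R * h) - L (t + i.+1%:R * h))).
    (* The last term is taken at [t + n.+2 * h], beyond 1, where [L] vanishes; what is left is
       [- L (t + h)]. *)
    rewrite (telescope_sumr (fun i => L (t + i.+1%:R * h)))// mul1r L1 ?sub0r//.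
    rewrite -natr1 mulrDl nh mul1r addrCA lerDl addr_ge0 ?ltW//.
apply: ereal_sup_ubound; exists n.+1, P; split => //.
- move=> i j _ _ [x [[_ xi] [_ xj]]]; apply: val_inj.
  by rewrite /= -xi -xj.
- apply/seteqP; split => x.
    by move=> [i _ /P01].
  rewrite /= in_itv/= => x01.
  have xn : (index x < n.+1)%N by rewrite ltnS geq_minl.
  by exists (Ordinal xn).
Qed.

End uniform_partition.

(** The lower bounds of the uniform partitions increase with [n], since [t + n.+1^-1] decreases to
    [t]; monotone convergence identifies their limit with the upper bound. *)
Lemma lorentz_variationE (phi : lorentz_weight R) :
  lorentz_variation phi `[0%R, 1%R] =
  (\int[mu]_(t in `]0%R, 1%R]) ((weight_density phi t)%:E * (ln (1 / t))%:E))%E.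
Proof.
apply/eqP; rewrite eq_le; apply/andP; split.
  apply: ge_ereal_sup => _ [n [P [mP tP UP ->]]].
  exact: sum_lorentz_norm_cesaro_le.
pose g n t := ((weight_density phi t)%:E * (- ln (Num.min (t + n.+1%:R^-1) 1))%:E)%E.
have min0 n t : 0 < t -> 0 < Num.min (t + n.+1%:R^-1) 1.
  by move=> t0; rewrite lt_min ltr01 andbT addr_gt0.
have cvg_g t : 0 < t <= 1 ->
    g n t @[n --> \oo] --> ((weight_density phi t)%:E * (ln (1 / t))%:E)%E.
  move=> /andP[t0 t1]; apply: cvg_EFin; first exact: nearW.
  apply: cvgM; first exact: cvg_cst.
  rewrite div1r lnV ?posrE//; apply: cvgN.
  apply: (@cvg_comp _ _ _ (fun n => Num.min (t + n.+1%:R^-1) 1) (@ln R) _ (nbhs t)).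
    have ct : t + n.+1%:R^-1 @[n --> \oo] --> t.
      rewrite -[X in _ --> X]addr0; apply: cvgD; first exact: cvg_cst.
      exact: cvg_harmonic.
    apply: squeeze_cvgr (cvg_cst t) ct; near=> n.
    by rewrite le_min lerDl invr_ge0 ler0n t1/= ge_min lexx.
  exact: continuous_ln.
have m01 : measurable (`]0, 1]%classic : set R) by exact: measurable_itv.
have := @monotone_convergence _ _ R mu _ m01 g.
have -> : (\int[mu]_(t in `]0%R, 1%R]) ((weight_density phi t)%:E * (ln (1 / t))%:E) =
    \int[mu]_(t in `]0%R, 1%R]) limn (g ^~ t))%E.
  apply: eq_integral => t /set_mem/=; rewrite in_itv/= => /cvg_g /cvg_lim.
  by move=> <-.
have mg n : measurable_fun (`]0, 1]%classic : set R) (g n).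
  apply: emeasurable_funM; first exact: emeasurable_weight_density.
  apply/measurable_EFinP; apply: measurable_funTS; apply: measurableT_comp => //.
  apply: (measurableT_comp (@measurable_ln R)).
  by apply: measurable_minr => //; exact: measurable_funD.
have g0 n t : `]0, 1]%classic t -> (0 <= g n t)%E.
  rewrite /= in_itv/= => /andP[t0 t1]; rewrite mule_ge0// lee_fin ?weight_density_ge0//.
  by rewrite oppr_ge0 ln_le0// ge_min lexx orbT.
have ndg t : `]0, 1]%classic t -> {homo g^~ t : n m / (n <= m)%N >-> (n <= m)%E}.
  rewrite /= in_itv/= => /andP[t0 t1] n m nm; apply: lee_wpmul2l.
    by rewrite lee_fin weight_density_ge0.
  rewrite lee_fin lerN2 ler_ln ?posrE ?min0// le_min ge_min lerD2l.
  by rewrite lef_pV2 ?posrE// ler_nat ltnS nm/= ge_min lexx orbT.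
move=> /(_ mg g0 ndg) ->; apply: lime_le.
  apply: ereal_nondecreasing_is_cvgn => n m nm; apply: ge0_le_integral => //.
  - exact: g0.
  - exact: mg.
  - exact: mg.
  - by move=> t t01; exact: ndg.
by apply: nearW => n; exact: lorentz_variation_ge.
Unshelve. all: by end_near. Qed.

End variation_ge.

(** * The norms of the kernels and the variation in terms of the derivative of the weight *)

Theorem proposition2p3 (R : realType) (phi : lorentz_weight R) :
  [/\ (forall y : R, 0 < y <= 1 ->
        lorentz_norm phi (Fker y) =
        lebesgue_integral `]0, (1 - y)[ (fun t => (derive1 phi t / (t + y))%:E)),
      lorentz_variation phi `[0, 1] =
        lebesgue_integral `]0, 1[ (fun t => (ln (1 / t) * derive1 phi t)%:E),
      finite_variation phi <-> in_lorentz phi (fun t => ln (1 / t)) &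
      (finite_variation phi ->
        lorentz_variation phi `[0, 1] = lorentz_norm phi (fun t => ln (1 / t)))].
Proof.
(* This equality holds in [[0, +oo]], so it also settles when the variation is finite. *)
have varE : lorentz_variation phi `[0, 1] = lorentz_norm phi (fun t => ln (1 / t)).
  by rewrite lorentz_norm_ln lorentz_variationE.
split.
- move=> y y01; have /andP[y0 y1] := y01.
  have y1' : 1 - y <= 1 by rewrite lerBlDr lerDl ltW.
  have my : measurable_fun `]0, (1 - y)[ (fun t : R => (t + y)^-1).
    apply: measurable_funTS; apply: (measurableT_comp measurable_invr).
    exact: measurable_funD.
  have h0 t : t \in `]0, (1 - y)[ -> 0 <= (t + y)^-1.
    rewrite in_itv/= => /andP[t0 _]; rewrite invr_ge0 addr_ge0//; exact: ltW.
  rewrite (lorentz_norm_Fker phi y01) -(integral_derive1_weight phi y1' my h0).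
  by congr lebesgue_integral; apply/funext => t; rewrite mulrC.
- have h0 t : t \in `]0, 1[ -> 0 <= ln (1 / t) :> R.
    by rewrite in_itv/= => /andP[t0 /ltW t1]; rewrite div1r ln_ge0// invf_ge1.
  rewrite lorentz_variationE.
  rewrite (integral_derive1_weight phi (lexx 1) (@measurable_ln_inv R _) h0).
  apply/esym; apply: integral_itv_bndo_bndc.
  apply: emeasurable_funM; first exact: emeasurable_weight_density.
  by apply/measurable_EFinP; exact: measurable_ln_inv.
- rewrite /finite_variation varE; split => [fin|[_]]; last by [].
  split; last exact: fin.
  apply: (measurable_fun_lebesgue (measurable_itv `[0, 1])).
  exact: measurable_ln_inv.
- by [].
Qed.
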